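(* Assume that $\langle\nu,e^{\alpha\phi}\rangle<\infty$ for every $\alpha>0$; that $\mathcal{I}$ is lower semi-continuous on $\mathcal{P}_\phi(E)$; that for every $s\in\mathcal{S}$ the function $\zeta_s$ is continuous on $E$ and there is $C_s^\zeta\in[0,\infty)$ with $|\zeta_s(x)|\le C_s^\zeta[1+\phi(x)]$ for all $x\in E$; and that for every $t\in\mathcal{T}$ the function $\Psi_t$ is lower semi-continuous on $\mathcal{P}_\phi(E)$. Let $\overline\mu$ be a minimiser of $\mathcal{I}$ over $\mathcal{D}_{\mathcal{I}}\cap\mathcal{A}^\zeta_\Psi$ (i.e. $\overline\mu\in\mathcal{D}_{\mathcal{I}}\cap\mathcal{A}^\zeta_\Psi$ and $\mathcal{I}(\overline\mu)=\inf_{\mathcal{D}_{\mathcal{I}}\cap\mathcal{A}^\zeta_\Psi}\mathcal{I}$) such that: (a) $\mathcal{D}_{\mathcal{I}}$ is convex and $\mathcal{F}$ is differentiable at $\overline\mu$ w.r.t. the set of directions $\mathcal{D}_{\mathcal{I}}$. (b) (i) $t\mapsto\Psi_t(\overline\mu)$ is continuous on $\mathcal{T}$; (ii) for every $t\in\mathcal{T}$, $\Psi_t$ is differentiable at $\overline\mu$ w.r.t. the set of directions $\mathcal{P}_\phi(E)$, uniformly in $t$ in the sense that for every $\mu\in\mathcal{P}_\phi(E)$, $$\lim_{\varepsilon\to0^+}\sup_{t\in\mathcal{T}}\left|\frac{\Psi_t((1-\varepsilon)\overline\mu+\varepsilon\mu)-\Psi_t(\overline\mu)}{\varepsilon}-\Big\langle\mu-\overline\mu,\frac{\delta\Psi_t}{\delta\mu}(\overline\mu)\Big\rangle\right|=0;$$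 (iii) for every $x\in E$, $t\mapsto\frac{\delta\Psi_t}{\delta\mu}(\overline\mu,x)$ is continuous; (iv) there is $D^\Psi\in[0,\infty)$ with $\sup_{t\in\mathcal{T}}|\frac{\delta\Psi_t}{\delta\mu}(\overline\mu,x)|\le D^\Psi[1+\phi(x)]$ for all $x\in E$; (v) there exist $\tilde\mu\in\mathcal{D}_{\mathcal{I}}\cap\mathcal{A}^\zeta$ and $\tilde\varepsilon>0$ such that $\Psi_t(\overline\mu)+\tilde\varepsilon\langle\tilde\mu-\overline\mu,\frac{\delta\Psi_t}{\delta\mu}(\overline\mu)\rangle<0$ for all $t\in\mathcal{T}$. (c) Every probability measure on $E$ that has a bounded density w.r.t. $\overline\mu$ or w.r.t. the measure $\tilde\mu$ of (b)(v) belongs to $\mathcal{D}_{\mathcal{I}}$. Then: 1. Every $\mu\in\mathcal{D}_{\mathcal{I}}\cap\mathcal{A}^\zeta$ is absolutely continuous w.r.t. $\overline\mu$. 2. There exist $(\overline\zeta,\overline\lambda)\in L^1(E,d\overline\mu)\times\mathcal{M}_+(\mathcal{T})$ and a measurable $\overline S\subset E$ such that $\overline\mu(\overline S)=1$, $$\overline Z:=\int_E\mathbf{1}_{\overline S}(x)\exp\Big[-\frac{\delta\mathcal{F}}{\delta\mu}(\overline\mu,x)-\overline\zeta(x)-\int_{\mathcal{T}}\frac{\delta\Psi_t}{\delta\mu}(\overline\mu,x)\,\overline\lambda(dt)\Big]\nu(dx)\in(0,\infty),$$ and $\overline\mu$ has density w.r.t. $\nu$ $$\frac{d\overline\mu}{d\nu}(x)=\frac1{\overline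 Z}\mathbf{1}_{\overline S}(x)\exp\Big[-\frac{\delta\mathcal{F}}{\delta\mu}(\overline\mu,x)-\overline\zeta(x)-\int_{\mathcal{T}}\frac{\delta\Psi_t}{\delta\mu}(\overline\mu,x)\,\overline\lambda(dt)\Big].$$ 3. The function $\overline\zeta$ belongs to the closure of $\mathrm{Span}(\zeta_s,s\in\mathcal{S})$ in $L^1(E,d\overline\mu)$, hence $\int_E\overline\zeta\,d\overline\mu=0$, and the complementary slackness condition holds: $\Psi_t(\overline\mu)=0$ for $\overline\lambda$-a.e. $t\in\mathcal{T}$.
   Context: $E$ is a complete separable metric space with its Borel $\sigma$-algebra, $\mathcal{P}(E)$ the set of Borel probability measures on $E$, and $\langle\mu,f\rangle:=\int_E f\,d\mu$. Fix a continuous $\phi:E\to[0,\infty)$ and $\nu\in\mathcal{P}(E)$. Set $\mathcal{P}_\phi(E):=\{\mu\in\mathcal{P}(E):\langle\mu,\phi\rangle<\infty\}$, with the (metrizable) topology in which $\mu_k\to\mu$ iff $\langle\mu_k,\phi\rangle\to\langle\mu,\phi\rangle$ and $\langle\mu_k,f\rangle\to\langle\mu,f\rangle$ for every bounded continuous $f$. $H(\mu|\nu):=\int_E\log\frac{d\mu}{d\nu}d\mu$ if $\mu\ll\nu$, $+\infty$ otherwise. $\mathcal{F}:\mathcal{P}_\phi(E)\to(-\infty,+\infty]$ is measurable, $\mathcal{I}:=H(\cdot|\nu)+\mathcal{F}$ on $\mathcal{P}_\phi(E)$, and $\mathcal{D}_{\mathcal{I}}:=\{\mu\in\mathcal{P}_\phi(E):H(\mu|\nu)<+\infty,\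 \mathcal{F}(\mu)<+\infty\}$. $\mathcal{S}$ is an arbitrary set, $(\zeta_s)_{s\in\mathcal{S}}$ a family of functions $E\to\mathbb{R}$; $\mathcal{T}$ is a compact metric space, $(\Psi_t)_{t\in\mathcal{T}}$ a family of functions $\mathcal{P}_\phi(E)\to\mathbb{R}$. Set $\mathcal{A}^\zeta:=\{\mu\in\mathcal{P}_\phi(E):\forall s\in\mathcal{S},\langle\mu,\zeta_s\rangle=0\}$, $\mathcal{A}_\Psi:=\{\mu\in\mathcal{P}_\phi(E):\forall t\in\mathcal{T},\Psi_t(\mu)\le0\}$, $\mathcal{A}^\zeta_\Psi:=\mathcal{A}^\zeta\cap\mathcal{A}_\Psi$. $\mathcal{M}_+(\mathcal{T})$ is the cone of (finite) positive Radon measures on $\mathcal{T}$. Linear functional derivative: for a convex set $\mathcal{C}\subset\mathcal{P}(E)$ and $\mu\in\mathcal{C}$, a map $F:\mathcal{C}\to\mathbb{R}$ is differentiable at $\mu$ w.r.t. the set of directions $\mathcal{C}$ if there is a measurable $\frac{\delta F}{\delta\mu}(\mu):E\to\mathbb{R}$, $x\mapsto\frac{\delta F}{\delta\mu}(\mu,x)$, such that for every $\mu'\in\mathcal{C}$ it is $\mu'$-integrable and $\varepsilon^{-1}[F((1-\varepsilon)\mu+\varepsilon\mu')-F(\mu)]\to\langle\mu'-\mu,\frac{\delta F}{\delta\mu}(\mu)\rangle$ as $\varepsilon\to0^+$. It is normalised by $\langle\mu,\frac{\delta F}{\delta\mu}(\mu)\rangle=0$. *)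

(* Defs.v *)
From HB Require Import structures.
From mathcomp Require Import all_boot all_order all_algebra finmap.
From mathcomp Require Import interval_inference.
From mathcomp Require Import all_classical all_reals all_analysis.
From mathcomp Require Import measurable_realfun ereal_normedtype.

Set Implicit Arguments.
Unset Strict Implicit.
Unset Printing Implicit Defensive.

Import Order.TTheory GRing.Theory Num.Theory.
Import numFieldNormedType.Exports.

Local Open Scope classical_set_scope.
Local Open Scope ring_scope.

#[short(type="pmetricType")]
HB.structure Definition PointedMetric (K : numDomainType) :=
  {M of Metric K M & isPointed M}.

#[short(type="completeMetricType")]
HB.structure Definition CompleteMetric (K : numDomainType) :=
  {M of Metric K M & Complete M}.

Definition separable (T : topologicalType) :=
  exists2 D : set T, countable D & dense D.

Notation borel T := (g_sigma_algebraType (@open T)).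

(* Stated on preimages rather than with [measurable_fun] because the latter
   requires a pointed domain. *)
Definition borel_measurable (R : realType) (T : topologicalType)
    (f : T -> \bar R) :=
  forall Y : set (\bar R), measurable Y -> <<s @open T >> (f @^-1` Y).

Definition radon (R : realType) (T : pmetricType R)
    (m : {measure set (borel T) -> \bar R}) :=
  forall A : set (borel T), measurable A ->
    m A = ereal_sup [set m K | K in [set K : set T | compact K /\ K `<=` A]].

Section mixture.
Context d (X : measurableType d) (R : realType).
Implicit Types (e : R) (mu : probability X R).

Definition clip01 e : R := Num.max 0 (Num.min e 1).

Lemma clip01_ge0 e : 0 <= clip01 e.
Proof. by rewrite le_max lexx. Qed.

Lemma onem_clip01_ge0 e : 0 <= 1 - clip01 e.
Proof. by rewrite subr_ge0 ge_max ler01 ge_min lexx orbT. Qed.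

Lemma clip01_id e : 0 <= e <= 1 -> clip01 e = e.
Proof. by case/andP=> e0 e1; rewrite /clip01 min_l// max_r. Qed.

(* The measure (1 - e) mu + e mu'; [clip01] only makes it a probability measure
   for e outside [0, 1] as well. *)
Definition pmix e mu mu' : set X -> \bar R :=
  measure_add (mscale (NngNum (onem_clip01_ge0 e)) mu)
              (mscale (NngNum (clip01_ge0 e)) mu').

HB.instance Definition _ e mu mu' := Measure.on (pmix e mu mu').

Lemma pmix_setT e mu mu' : pmix e mu mu' setT = 1%E.
Proof.
rewrite /pmix measure_addE /mscale/=.
rewrite [X in (_ * X + _)%E]probability_setT [X in (_ + _ * X)%E]probability_setT.
by rewrite !mule1 -EFinD subrK.
Qed.

HB.instance Definition _ e mu mu' :=
  Measure_isProbability.Build _ _ _ (pmix e mu mu') (pmix_setT e mu mu').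

Lemma pmixE e mu mu' (A : set X) : 0 <= e <= 1 ->
  pmix e mu mu' A = ((1 - e)%:E * mu A + e%:E * mu' A)%E.
Proof.
move=> e01; rewrite /pmix measure_addE -[LHS]/(_%:E * _ + _%:E * _)%E/=.
by rewrite clip01_id.
Qed.

End mixture.

Section weighted_probability.
Context (R : realType) (E : completeMetricType R).

Record Pphi (phi : E -> R) := MkPphi {
  Pphi_prob :> probability (borel E) R ;
  _ : (\int[Pphi_prob]_x (phi x)%:E < +oo)%E }.

HB.instance Definition _ phi := [isSub for @Pphi_prob phi].
HB.instance Definition _ phi := [Choice of Pphi phi by <:].

Variable phi : E -> R.
Implicit Types mu : Pphi phi.

Definition test_function : set (E -> R) :=
  [set f | f = phi \/ (continuous f /\ bounded_fun f)].

Definition Pphi_subbase : set (set (Pphi phi)) :=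
  [set A | exists2 f, test_function f & exists2 U : set R, open U &
     A = [set mu : Pphi phi | U (\int[mu]_x f x)]].

(* The coarsest topology making mu |-> <mu, f> continuous for f = phi and for
   every bounded continuous f; see [cvg_PphiP].  Measures that agree on Borel
   sets but differ as Rocq functions have the same neighbourhoods, hence are
   not distinguished by Borel or lower semicontinuous functions. *)
HB.instance Definition _ :=
  @isSubBaseTopological.Build (Pphi phi) (set (Pphi phi)) Pphi_subbase id.

Lemma cvg_PphiP (F : set_system (Pphi phi)) mu : Filter F ->
  F --> mu <-> (forall f, test_function f ->
    (\int[m : Pphi phi]_x f x) @[m --> F] --> (\int[mu]_x f x : R)).
Proof.
move=> FF; split=> [Fmu f tf|H].
  move=> V; rewrite nbhsE => -[U [oU Umu] UV].
  suff FU : F [set m | U (\int[m : Pphi phi]_x f x)].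
    by apply: filterS FU => m /= /UV.
  apply: Fmu; apply: open_nbhs_nbhs; split=> //=.
  exists [set [set m | U (\int[m : Pphi phi]_x f x)]]; last by rewrite bigcup_set1.
  move=> _ ->; exists [fset [set m | U (\int[m : Pphi phi]_x f x)]]%fset.
    move=> A /fset1P AE; rewrite inE; change (Pphi_subbase A).
    by exists f => //; exists U.
  rewrite predeqE => m; split=> [Hm|Um i /=]; first exact: (Hm _ (fset11 _)).
  by move=> /fset1P ->.
move=> V; rewrite nbhsE => -[_ [[B sB <-] [C BC Cmu]] UV].
apply: filterS UV _; apply: (@filterS _ F _ C); first by move=> ? ?; exists C.
have [D sD IDC] := sB _ BC; rewrite -IDC in Cmu *.
apply: filter_bigI => A DA.
have := sD _ DA; rewrite inE => -[f tf [U oU AE]].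
have Amu := Cmu _ DA; rewrite /= AE in Amu *.
exact: (H f tf U (open_nbhs_nbhs (conj oU Amu))).
Qed.

(* The mixture (1 - e) mu + e mu' in P_phi; the default value of [insubd] is
   never reached, see [Pphi_prob_mix]. *)
Definition mix (e : R) mu mu' : Pphi phi := insubd mu (pmix e mu mu').

Lemma Pphi_prob_mix e mu mu' : continuous phi -> (forall x, 0 <= phi x) ->
  (mix e mu mu' : probability (borel E) R) = pmix e mu mu'.
Proof.
move=> cphi phi0; rewrite /mix -[LHS]/(val _) insubdK// unfold_in/=.
have mphi : measurable_fun [set: borel E] (EFin \o phi).
  apply/measurable_EFinP; apply: (measurability (@RGenOpens.G R)).
    exact: RGenOpens.measurableE.
  move=> _ [_ [a [b ->]] <-]; rewrite setTI; apply: sub_sigma_algebra.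
  by move/continuousP : cphi; apply; exact: interval_open.
have phi0E (x : borel E) : [set: borel E] x -> (0 <= (EFin \o phi) x)%E.
  by rewrite /= lee_fin.
rewrite /pmix ge0_integral_measure_add// !ge0_integral_mscale//.
by case: mu mu' => [? ?] [? ?]; rewrite lte_add_pinfty// lte_mul_pinfty// lee_fin.
Qed.

Definition convexP (C : set (Pphi phi)) := forall mu mu' e,
  C mu -> C mu' -> 0 <= e <= 1 -> C (mix e mu mu').

Definition diff_quotient (F : Pphi phi -> R) mu mu' (e : R) : R :=
  e^-1 * (F (mix e mu mu') - F mu).

(* [df] is the (normalised) linear functional derivative at [mu] of [F],
   restricted to [C], w.r.t. the set of directions [C]. *)
Definition is_lfderiv (C : set (Pphi phi)) (F : Pphi phi -> R) mu
    (df : E -> R) :=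
  [/\ measurable_fun [set: borel E] df,
      forall mu', C mu' -> mu'.-integrable [set: borel E] (EFin \o df),
      forall mu', C mu' -> diff_quotient F mu mu' e @[e --> 0^'+] -->
        (\int[mu']_x df x - \int[mu]_x df x : R) &
      \int[mu]_x df x = 0].

End weighted_probability.

Section densities.
Context d (X : measurableType d) (R : realType).
Implicit Types (mu nu : probability X R) (g : X -> R).
Local Open Scope ereal_scope.
Local Open Scope charge_scope.

Definition rel_entropy mu nu : \bar R :=
  if `[< mu `<< nu >]
  then \int[mu]_x lne (('d (charge_of_finite_measure mu) '/d nu) x) else +oo.

Definition has_density mu nu g := mu `<< nu /\
  ae_eq nu [set: X] ('d (charge_of_finite_measure mu) '/d nu) (EFin \o g).

Definition has_bounded_density mu nu :=
  exists2 g, has_density mu nu g & bounded_fun g.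

End densities.

Definition lin_span (R : realType) (X S : Type) (zeta : S -> X -> R) : set (X -> R) :=
  [set h | exists n (s : 'I_n -> S) (c : 'I_n -> R),
     h = fun x => \sum_(i < n) c i * zeta (s i) x].

Definition L1_closure (R : realType) d (X : measurableType d)
    (mu : probability X R) (A : set (X -> R)) : set (X -> R) :=
  [set f | f \in Lfun mu 1%E /\ forall e : R, 0 < e ->
     exists2 h, A h & ('N[mu]_1 [EFin \o (f \- h)%R] < e%:E)%E].

Section problem.
Context (R : realType) (E : completeMetricType R) (phi : E -> R).
Variables (nu : probability (borel E) R) (F : Pphi phi -> \bar R).
Local Open Scope ereal_scope.

Definition objective (mu : Pphi phi) : \bar R := rel_entropy mu nu + F mu.

Definition dom_objective : set (Pphi phi) :=
  [set mu : Pphi phi | rel_entropy mu nu < +oo /\ F mu < +oo].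

Definition eq_constraint (S : Type) (zeta : S -> E -> R) : set (Pphi phi) :=
  [set mu : Pphi phi | forall s, \int[mu]_x (zeta s x)%:E = 0].

Definition ineq_constraint (T : Type) (Psi : T -> Pphi phi -> R) :
    set (Pphi phi) :=
  [set mu : Pphi phi | forall t, (Psi t mu <= 0)%R].

End problem.

(* Unnormalised Gibbs weight
   1_S(x) exp[- df(x) - z(x) - int_T dPsi_t(x) lambda(dt)]. *)
Definition gibbs_weight (R : realType) (E : completeMetricType R)
    (T : pmetricType R) (S : set E) (df z : E -> R) (dPsi : T -> E -> R)
    (lambda : {measure set (borel T) -> \bar R}) (x : E) : R :=
  \1_S x * expR (- df x - z x - \int[lambda]_t dPsi t x).

(* Main.v *)
Require Import Defs.
From HB Require Import structures.
From mathcomp Require Import all_boot all_order all_algebra finmap.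
From mathcomp Require Import interval_inference.
From mathcomp Require Import all_classical all_reals all_analysis.
From mathcomp Require Import measurable_realfun ereal_normedtype.
From mathcomp Require Import ring lra.

(** Write [f] for the density of [mubar] with respect to [nu], [h x = x ln x],
    and let [mu] be an admissible measure satisfying the linearised inequality
    constraints strictly.  The mixtures of [mubar] with a little of [mu] satisfy
    all the constraints, so that optimality of [mubar] bounds from below the
    difference quotients of the entropy.  Convexity of [h] and Fatou's lemma turn
    this into: [mu] is dominated by [mubar], [ln f] is [mu]-integrable and
    [<mu - mubar, ln f + dF> >= 0].  Mixing with [mutilde] extends the first two
    claims to every admissible measure.

    The inequality says that a convex program has value [0]; a Hahn-Banach
    multiplier for it is a positive functional on bounded functions of [t], which
    agrees with a Radon measure [lambda] on continuous functions.  With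
    [G := ln f + dF + int dPsi_t lambda(dt)] one gets [<mu - mubar, G> >= 0] for
    every admissible [mu], and complementary slackness by taking [mu = mubar].
    Testing against the measures with density [1 + k h], [h] bounded and
    orthogonal to [1] and to the [zeta_s], shows that [G] is annihilated by all
    such [h]; by the duality of [L^1] and [L^oo], [G] is in the closed span of
    [1] and the [zeta_s].  Then [zetabar := <mubar, G> - G]. *)

(** Nothing bounds [f] away from zero, so neither domination by [mubar] nor integrability of [ln f]
    under another [mu] can be presupposed. Both come out of one finite integral. The integrand in
    Fatou's lemma is a fixed [nu]-integrable function minus the derivative of [h] along the segment,
    and its limit is infinite exactly where [f] vanishes and the density of [mu] does not.

    The linearised inequality must be strict, uniformly in [t], to absorb the error of
    linearisation; [mubar] itself satisfies it only weakly. Hence the form of the convex program: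
    nonnegativity is assumed at strictly feasible points only, and a Slater point, here [mutilde],
    gives access to the others.

    The multiplier acts on all bounded functions of [t], continuous or not, for the sake of the
    Riesz theorem: [T] is a continuous image of the Cantor space, and the functional is moved there
    along a section that is in general discontinuous. On the Cantor space, indicators of clopen sets
    are continuous, and their values under the functional give the measure directly. *)

Set Implicit Arguments.
Unset Strict Implicit.
Unset Printing Implicit Defensive.

Import Order.TTheory GRing.Theory Num.Theory.
Import numFieldNormedType.Exports.

Local Open Scope classical_set_scope.
Local Open Scope ring_scope.

(** * The Hahn-Banach theorem *)

Section hahn_banach.
Context {R : realType} {V : lmodType R} (W : set V).
Hypothesis WD : forall u v, W u -> W v -> W (u + v).
Hypothesis WZ : forall c u, W u -> W (c *: u).

Definition sublinear_on (q : V -> R) :=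
  (forall u v, W u -> W v -> q (u + v) <= q u + q v) /\
  (forall c u, 0 < c -> W u -> q (c *: u) = c * q u).

Let WN u : W u -> W (- u).
Proof. by rewrite -scaleN1r; exact: WZ. Qed.

Lemma sublinear_on0 q : W 0 -> sublinear_on q -> q 0 = 0.
Proof.
move=> W0 [_ /(_ 2 0 ltac:(by []) W0)]; rewrite scaler0 => H; lra.
Qed.

Lemma sublinear_onN q u : sublinear_on q -> W u -> - q (- u) <= q u.
Proof.
move=> qs Wu; have W0 : W 0 by rewrite -(scale0r u); exact: WZ.
have := qs.1 _ _ Wu (WN Wu); rewrite subrr (sublinear_on0 W0 qs); lra.
Qed.

(* The infimum of [q] along the rays directed by [y]: the largest sublinear
   minorant of [q] that is at most [- q y] at [- y]. *)
Definition sublinear_shift (q : V -> R) y x :=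
  inf [set q (x + t *: y) - t * q y | t in [set t : R | 0 <= t]].

Lemma sublinear_shift_has_inf q y x : sublinear_on q -> W y -> W x ->
  has_inf [set q (x + t *: y) - t * q y | t in [set t : R | 0 <= t]].
Proof.
move=> qs Wy Wx; split; first by exists (q (x + 0 *: y) - 0 * q y), 0 => /=.
exists (- q (- x)) => _ [t /= t0 <-].
have W0 : W 0 by rewrite -(scale0r y); exact: WZ.
have tq : q (t *: y) = t * q y.
  move: t0; rewrite le_eqVlt => /predU1P[<-|t0]; last exact: qs.2.
  by rewrite scale0r mul0r (sublinear_on0 W0).
have := qs.1 (x + t *: y) (- x) (WD Wx (WZ _ Wy)) (WN Wx).
rewrite addrC addKr tq; lra.
Qed.

Lemma sublinear_shift_le q y x t : sublinear_on q -> W y -> W x -> 0 <= t ->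
  sublinear_shift q y x <= q (x + t *: y) - t * q y.
Proof.
move=> qs Wy Wx t0; apply: ge_inf; last by exists t.
by have [] := sublinear_shift_has_inf qs Wy Wx.
Qed.

Lemma sublinear_shift_ge q y x z : sublinear_on q -> W y -> W x ->
  (forall t, 0 <= t -> z <= q (x + t *: y) - t * q y) ->
  z <= sublinear_shift q y x.
Proof.
move=> qs Wy Wx zq; apply: lb_le_inf => [|_ [t /= t0 <-]]; last exact: zq.
exact: (sublinear_shift_has_inf qs Wy Wx).1.
Qed.

Lemma sublinear_shift_sublinear q y : sublinear_on q -> W y ->
  sublinear_on (sublinear_shift q y).
Proof.
move=> qs Wy; split.
  move=> u v Wu Wv; rewrite -lerBlDr.
  apply: sublinear_shift_ge => // t t0.
  rewrite lerBlDr [leRHS]addrC -lerBlDr.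
  apply: sublinear_shift_ge => // s s0.
  have := sublinear_shift_le qs Wy (WD Wu Wv) (addr_ge0 t0 s0).
  have := qs.1 _ _ (WD Wu (WZ t Wy)) (WD Wv (WZ s Wy)).
  rewrite addrACA -scalerDl; lra.
have shiftZ c u : 0 < c -> W u ->
    sublinear_shift q y (c *: u) <= c * sublinear_shift q y u.
  move=> c0 Wu; rewrite -ler_pdivrMl//; apply: sublinear_shift_ge => // t t0.
  rewrite ler_pdivrMl//.
  have := sublinear_shift_le qs Wy (WZ c Wu) (mulr_ge0 (ltW c0) t0).
  rewrite -scalerA -scalerDr qs.2//; last by apply: WD => //; exact: WZ.
  by rewrite mulrBr mulrA.
move=> c u c0 Wu; apply/eqP; rewrite eq_le shiftZ//=.
rewrite -ler_pdivlMl//; have := shiftZ c^-1 (c *: u).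
by rewrite scalerA mulVf ?gt_eqF// scale1r; apply; rewrite ?invr_gt0//; exact: WZ.
Qed.

(** Zorn's lemma for the reversed pointwise order, a mere preorder because functionals are compared
    on [W] only. A chain is bounded by its pointwise infimum, which is finite since
    [- q0 (- u) <= q u]. It is subadditive because the smaller of two members of the chain serves
    for both arguments. *)
Lemma sublinear_minimal q0 : sublinear_on q0 -> exists q,
  [/\ sublinear_on q, forall u, W u -> q u <= q0 u &
      forall q', sublinear_on q' -> (forall u, W u -> q' u <= q u) ->
        forall u, W u -> q u <= q' u].
Proof.
move=> q0s.
pose T := {q | sublinear_on q /\ forall u, W u -> q u <= q0 u}.
have Tlow (q : T) u : W u -> - q0 (- u) <= sval q u.
  case: q => q [qs qq0] /= Wu; rewrite (le_trans _ (sublinear_onN qs Wu))//.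
  by rewrite lerN2; exact/qq0/WN.
pose le (q1 q2 : T) := `[< forall u, W u -> sval q2 u <= sval q1 u >].
have [|||q qmax] := @ZL_preorder T (exist _ q0 (conj q0s (fun _ _ => lexx _))) le.
- by move=> q; apply/asboolP.
- move=> q1 q2 q3 /asboolP q12 /asboolP q23; apply/asboolP => u Wu.
  by rewrite (le_trans (q23 _ Wu))// q12.
- move=> A Atot; have [[q1 Aq1]|A0] := pselect (exists q, A q); last first.
    exists (exist _ q0 (conj q0s (fun _ _ => lexx _))) => q Aq.
    by exfalso; apply: A0; exists q.
  pose m u := inf [set sval q u | q in A].
  have hm u : W u -> has_inf [set sval q u | q in A].
    move=> Wu; split; first by exists (sval q1 u), q1.
    by exists (- q0 (- u)) => _ [q Aq <-]; exact: Tlow.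
  have mle u q : W u -> A q -> m u <= sval q u.
    by move=> Wu Aq; apply: ge_inf; [exact: (hm _ Wu).2|exists q].
  have ms : sublinear_on m.
    split.
      move=> u v Wu Wv; rewrite -lerBlDr.
      apply: lb_le_inf => [|_ [q Aq <-]]; first exact: (hm _ Wu).1.
      rewrite lerBlDr [leRHS]addrC -lerBlDr.
      apply: lb_le_inf => [|_ [q' Aq' <-]]; first exact: (hm _ Wv).1.
      rewrite lerBlDr [leRHS]addrC.
      have [/asboolP qq'|/asboolP qq'] := Atot _ _ Aq Aq'.
        rewrite (le_trans (mle _ _ (WD Wu Wv) Aq'))//.
        rewrite (le_trans ((svalP q').1.1 _ _ Wu Wv))// lerD2r.
        exact: qq'.
      rewrite (le_trans (mle _ _ (WD Wu Wv) Aq))//.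
      rewrite (le_trans ((svalP q).1.1 _ _ Wu Wv))// lerD2l.
      exact: qq'.
    have mZ c u : 0 < c -> W u -> m (c *: u) <= c * m u.
      move=> c0 Wu; rewrite -ler_pdivrMl//.
      apply: lb_le_inf => [|_ [q Aq <-]]; first exact: (hm _ Wu).1.
      rewrite ler_pdivrMl// -(svalP q).1.2//.
      by apply: mle => //; exact: WZ.
    move=> c u c0 Wu; apply/eqP; rewrite eq_le mZ//= -ler_pdivlMl//.
    have := mZ c^-1 (c *: u); rewrite scalerA mulVf ?gt_eqF// scale1r.
    by apply; rewrite ?invr_gt0//; exact: WZ.
  have mq0 u : W u -> m u <= q0 u.
    by move=> Wu; rewrite (le_trans (mle _ _ Wu Aq1))//; exact: (svalP q1).2.
  exists (exist _ m (conj ms mq0)) => q Aq; apply/asboolP => u Wu /=.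
  exact: mle.
exists (sval q); split; [exact: (svalP q).1|exact: (svalP q).2|].
move=> q' q's q'q u Wu.
have q'q0 v : W v -> q' v <= q0 v.
  by move=> Wv; rewrite (le_trans (q'q _ Wv))//; exact: (svalP q).2.
have /asboolP := qmax (exist _ q' (conj q's q'q0)) ltac:(exact/asboolP).
exact.
Qed.

(* A minimal sublinear functional is unchanged by [sublinear_shift], which
   makes it additive. *)
Theorem hahn_banach p v0 : sublinear_on p -> W v0 -> exists l : V -> R,
  [/\ forall u v, W u -> W v -> l (u + v) = l u + l v,
      forall c u, W u -> l (c *: u) = c * l u,
      forall u, W u -> l u <= p u & l v0 = p v0].
Proof.
move=> ps Wv0.
have W0 : W 0 by rewrite -(scale0r v0); exact: WZ.
(* Minimising below the shift of [p] along [v0], instead of below [p] itself, forces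
   [l (- v0) <= - p v0], hence [l v0 = p v0]. *)
have [l [ls lp lmin]] := sublinear_minimal (sublinear_shift_sublinear ps Wv0).
have lD u v : W u -> W v -> l (u + v) = l u + l v.
  move=> Wu Wv; apply/eqP; rewrite eq_le ls.1//=.
  have := lmin _ (sublinear_shift_sublinear ls Wv) _ u Wu.
  have sh x t := @sublinear_shift_le l v x t ls Wv.
  move=> /(_ _)/le_trans; rewrite -lerBrDr; apply.
    move=> x Wx; have := sh x 0 Wx (lexx _).
    by rewrite scale0r addr0 mul0r subr0.
  by have := sh u 1 Wu ler01; rewrite scale1r mul1r.
have lN u : W u -> l (- u) = - l u.
  by move=> Wu; have := lD _ _ Wu (WN Wu); rewrite subrr (sublinear_on0 W0 ls); lra.
exists l; split => //.
- move=> c u Wu; have [c0|c0|<-] := ltgtP 0 c; first exact: ls.2.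
  + rewrite -[c]opprK scaleNr lN; last exact: WZ.
    by rewrite ls.2// ?oppr_gt0// -mulNr.
  + by rewrite scale0r mul0r (sublinear_on0 W0).
- move=> u Wu; rewrite (le_trans (lp _ Wu))//.
  have := sublinear_shift_le ps Wv0 Wu (lexx 0).
  by rewrite scale0r addr0 mul0r subr0.
- have sh x t := @sublinear_shift_le p v0 x t ps Wv0.
  apply/eqP; rewrite eq_le; apply/andP; split.
    rewrite (le_trans (lp _ Wv0))//; have := sh v0 0 Wv0 (lexx _).
    by rewrite scale0r addr0 mul0r subr0.
  have := le_trans (lp _ (WN Wv0)) (sh _ 1 (WN Wv0) ler01).
  by rewrite scale1r addNr (sublinear_on0 W0 ps) mul1r lN// sub0r lerN2.
Qed.

End hahn_banach.

(** * Lagrange multipliers *)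

Definition bounded_functions (R : realType) (T : Type) : set (T -> R) :=
  [set f | exists M, forall t, `|f t| <= M].

Section bounded_functions.
Context {R : realType} {T : Type}.
Implicit Types (f g : T -> R).

Lemma bounded_functionsD f g : bounded_functions f -> bounded_functions g ->
  bounded_functions (f + g).
Proof.
move=> [M fM] [N gN]; exists (M + N) => t.
by rewrite (le_trans (ler_normD _ _))// lerD.
Qed.

Lemma bounded_functionsZ c f : bounded_functions f ->
  bounded_functions (c *: f).
Proof.
move=> [M fM]; exists (`|c| * M) => t.
by rewrite normrM ler_wpM2l.
Qed.

Lemma bounded_functions_cst c : bounded_functions (cst c : T -> R).
Proof. by exists `|c|. Qed.

Definition positive_linear (L : (T -> R) -> R) :=
  [/\ forall f g, bounded_functions f -> bounded_functions g ->
        L (f + g) = L f + L g,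
      forall c f, bounded_functions f -> L (c *: f) = c * L f &
      forall f, bounded_functions f -> (forall t, 0 <= f t) -> 0 <= L f].

End bounded_functions.

Section lagrange_multiplier.
Context {R : realType} {T I : Type} (C : set I) (a : I -> R) (b : I -> T -> R).
Hypothesis b_bounded : forall i, C i -> bounded_functions (b i).
Hypothesis conv : forall i j e, C i -> C j -> 0 <= e <= 1 ->
  exists k, [/\ C k, a k = (1 - e) * a i + e * a j &
    forall t, b k t = (1 - e) * b i t + e * b j t].
Hypothesis a_ge0 : forall i e, C i -> 0 < e -> (forall t, b i t <= - e) ->
  0 <= a i.
Variables (i0 : I) (e0 : R).
Hypotheses (Ci0 : C i0) (e0_gt0 : 0 < e0) (slater : forall t, b i0 t <= - e0).

(** Convexity in homogeneous form: the mixture has parameter [s' / (s + s')]. Like [conv], it speaks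
    only of the values of [a] and [b], since probability measures come without a linear
    structure. *)
Let cone i j s s' : C i -> C j -> 0 <= s -> 0 <= s' -> 0 < s + s' ->
  exists k, [/\ C k, (s + s') * a k = s * a i + s' * a j &
    forall t, (s + s') * b k t = s * b i t + s' * b j t].
Proof.
move=> Ci Cj s0 s'0 ss'; have ne : s + s' != 0 by rewrite gt_eqF.
have [|k [Ck ak bk]] := @conv i j (s' / (s + s')) Ci Cj.
  by rewrite divr_ge0 ?(ltW ss')//= ler_pdivrMr// mul1r lerDr.
by exists k; split => // [|t]; rewrite ?ak ?bk; field.
Qed.

(* The value function of the homogenised program under the perturbation [y] of
   the constraints. *)
Let values (y : T -> R) : set R :=
  [set z | exists s i, [/\ 0 <= s, C i, forall t, s * b i t <= y t & z = s * a i]].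

Let p y := inf (values y).

(** Adding the Slater point with weight [(M + 1) / e0] pushes the constraints of any feasible pair
    down to at most [M - (M + 1) = -1]. The combined point is strictly feasible, so [a_ge0] applies
    to it. *)
Let values_lb y M : 0 <= M -> (forall t, `|y t| <= M) ->
  lbound (values y) (- ((M + 1) / e0 * a i0)).
Proof.
move=> M0 yM _ [s [i [s0 Ci sy ->]]].
have s'0 : 0 < (M + 1) / e0 by rewrite divr_gt0// ltr_wpDl.
have ss' : 0 < s + (M + 1) / e0 by rewrite ltr_wpDl.
have [k [Ck ak bk]] := cone Ci Ci0 s0 (ltW s'0) ss'.
suff : 0 <= (s + (M + 1) / e0) * a k by rewrite ak; lra.
rewrite mulr_ge0 ?(ltW ss')//.
apply: (@a_ge0 _ (s + (M + 1) / e0)^-1 Ck); first by rewrite invr_gt0.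
move=> t; rewrite -(ler_pM2l ss') bk mulrN divff ?gt_eqF//.
have := ler_wpM2l (ltW s'0) (slater t).
rewrite mulrN divfK ?gt_eqF//.
by have := sy t; have := yM t; rewrite ler_norml => /andP[_]; lra.
Qed.

Let values_has_inf y : bounded_functions y -> has_inf (values y).
Proof.
move=> [M yM]; split; last first.
  exists (- ((`|M| + 1) / e0 * a i0)); apply: values_lb => // t.
  by rewrite (le_trans (yM t))// ler_norm.
have M0 : 0 <= `|M| / e0 by rewrite divr_ge0// ltW.
exists (`|M| / e0 * a i0), (`|M| / e0), i0; split=> // t.
rewrite (le_trans (ler_wpM2l M0 (slater t)))// mulrN divfK ?gt_eqF//.
have := yM t; rewrite ler_norml => /andP[+ _]; apply: le_trans.
by rewrite lerN2 ler_norm.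
Qed.

Let p_le y s i : bounded_functions y -> 0 <= s -> C i ->
  (forall t, s * b i t <= y t) -> p y <= s * a i.
Proof.
move=> yB s0 Ci sy; apply: ge_inf; first exact: (values_has_inf yB).2.
by exists s, i.
Qed.

Let p_sublinear : sublinear_on (@bounded_functions R T) p.
Proof.
split.
  move=> u v Bu Bv; rewrite -lerBlDr.
  apply: lb_le_inf; first exact: (values_has_inf Bu).1.
  move=> _ [s [i [s0 Ci su ->]]]; rewrite lerBlDr [leRHS]addrC -lerBlDr.
  apply: lb_le_inf; first exact: (values_has_inf Bv).1.
  move=> _ [s' [j [s'0 Cj sv ->]]]; rewrite lerBlDr [leRHS]addrC.
  have [ss'|ss'] := ltP 0 (s + s').
    have [k [Ck ak bk]] := cone Ci Cj s0 s'0 ss'.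
    rewrite -ak; apply: p_le; [exact: bounded_functionsD|exact: ltW|by []|].
    by move=> t; rewrite bk lerD.
  (* Two zero weights admit no mixture; but then [u] and [v] are nonnegative, and weight [0] on [i]
     is feasible for [u + v]. *)
  have [s_0 s'_0] : s = 0 /\ s' = 0 by split; lra.
  rewrite s_0 s'_0 !mul0r addr0 -(mul0r (a i)); apply: p_le => //.
    exact: bounded_functionsD.
  move=> t; have := su t; have := sv t; rewrite s_0 s'_0 !mul0r.
  by move=> v0 u0; exact: (@addr_ge0 _ (u t) (v t)).
have pZ c u : 0 < c -> bounded_functions u -> p (c *: u) <= c * p u.
  move=> c0 Bu; rewrite -ler_pdivrMl//.
  apply: lb_le_inf; first exact: (values_has_inf Bu).1.
  move=> _ [s [i [s0 Ci su ->]]]; rewrite ler_pdivrMl// mulrA.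
  apply: p_le => //; [exact: bounded_functionsZ|by rewrite mulr_ge0// ltW|].
  by move=> t; rewrite -mulrA ler_pM2l.
move=> c u c0 Bu; apply/eqP; rewrite eq_le pZ//= -ler_pdivlMl//.
have := pZ c^-1 (c *: u); rewrite scalerA mulVf ?gt_eqF// scale1r.
by apply; rewrite ?invr_gt0//; exact: bounded_functionsZ.
Qed.

(** The multiplier is [- l] for a linear [l <= p]. Weight [0] shows that [p] is nonpositive at
    nonnegative perturbations, whence positivity; weight [1] at [i] shows [p (b i) <= a i], whence
    the inequality. *)
Theorem lagrange_multiplier : exists2 L : (T -> R) -> R, positive_linear L &
  forall i, C i -> 0 <= a i + L (b i).
Proof.
have [l [lD lZ lp _]] := hahn_banach (@bounded_functionsD R T)
  (@bounded_functionsZ R T) p_sublinear (bounded_functions_cst 0).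
exists (fun y => - l y); first split.
- by move=> f g Bf Bg; rewrite lD// opprD.
- by move=> c f Bf; rewrite lZ// mulrN.
- move=> f Bf f0; rewrite oppr_ge0 (le_trans (lp _ Bf))// -(mul0r (a i0)).
  by apply: p_le => // t; rewrite mul0r.
move=> i Ci; rewrite subr_ge0 -[leRHS]mul1r (le_trans (lp _ (b_bounded Ci)))//.
by apply: p_le => // [|t]; [exact: b_bounded|rewrite mul1r].
Qed.

End lagrange_multiplier.

(** * The Riesz representation theorem on a compact metric space *)

Section positive_linear_lemmas.
Context {R : realType} {T : Type} (L : (T -> R) -> R).
Hypothesis Lpos : positive_linear L.
Implicit Types (f g : T -> R) (A B : set T).

Lemma bounded_functions_indic A : bounded_functions (\1_A : T -> R).
Proof.
exists 1 => t; rewrite indicE; case: (t \in A); by rewrite ?normr1 ?normr0.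
Qed.

Lemma bounded_functionsM f g : bounded_functions f -> bounded_functions g ->
  bounded_functions (f * g).
Proof.
move=> [M fM] [N gN]; exists (M * N) => t.
by rewrite normrM ler_pM.
Qed.

Lemma positive_linearB f g : bounded_functions f -> bounded_functions g ->
  L (f - g) = L f - L g.
Proof.
move=> Bf Bg; have [LD LZ _] := Lpos.
rewrite -scaleN1r LD//; last exact: bounded_functionsZ.
by rewrite LZ// mulN1r.
Qed.

Lemma positive_linear_le f g : bounded_functions f -> bounded_functions g ->
  (forall t, f t <= g t) -> L f <= L g.
Proof.
move=> Bf Bg fg; rewrite -subr_ge0 -positive_linearB//.
have [_ _] := Lpos; apply => [|t]; last by rewrite subr_ge0.
by rewrite -scaleN1r; apply: bounded_functionsD => //; exact: bounded_functionsZ.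
Qed.

Lemma positive_linear0 : L (cst 0) = 0.
Proof.
have [_ /(_ 0 (cst 0) (bounded_functions_cst _)) + _] := Lpos.
by rewrite scale0r mul0r.
Qed.

Lemma positive_linear_norm f g : bounded_functions f -> bounded_functions g ->
  (forall t, `|f t| <= g t) -> `|L f| <= L g.
Proof.
move=> Bf Bg fg; have [_ LZ _] := Lpos.
rewrite ler_norml -mulN1r -LZ//; apply/andP; split; apply: positive_linear_le => //.
- exact: bounded_functionsZ.
- move=> t; rewrite -[leLHS]/(-1 * g t) mulN1r.
  by have := fg t; rewrite ler_norml => /andP[].
- by move=> t; have := fg t; rewrite ler_norml => /andP[].
Qed.

End positive_linear_lemmas.

Lemma indic_setU_disjoint (R : pzRingType) T (A B : set T) : A `&` B = set0 ->
  \1_(A `|` B) = \1_A + \1_B :> (T -> R).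
Proof.
move=> AB0; apply/funext => t; rewrite -[RHS]/(\1_A t + \1_B t) !indicE in_setU.
have [At|At] := boolP (t \in A); have [Bt|Bt] := boolP (t \in B) => /=.
- by have : (A `&` B) t by [split; exact: set_mem]; rewrite AB0.
- by rewrite addr0.
- by rewrite add0r.
- by rewrite addr0.
Qed.

Definition clopen_type (K : ptopologicalType) : Type := K.

Section clopen_ring.
Variable K : ptopologicalType.

Let clopenD : setD_closed (@clopen K).
Proof. by move=> A B cA cB; rewrite setDE; apply: clopenI => //; exact: clopenC. Qed.

HB.instance Definition _ := Pointed.on (clopen_type K).
HB.instance Definition _ := @isRingOfSets.Build default_measure_display
  (clopen_type K) (@clopen K) clopen0 (@clopenU K) clopenD.

End clopen_ring.

(** A clopen union is closed in a compact space, hence compact, and finitely many of the open sets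
    [F i] cover it. Countable additivity on clopen sets thereby reduces to finite additivity. *)
Lemma clopen_decreasing_cover (K : ptopologicalType) (F : (set K)^nat) :
  compact [set: K] -> (forall i, clopen (F i)) -> clopen (\bigcup_i F i) ->
  exists n, \bigcup_i F i = \bigcup_(i < n) F i.
Proof.
move=> cK cF [_ cU].
have : compact (\bigcup_i F i) by exact: (subclosed_compact _ cK).
rewrite compact_cover => /(_ nat setT F)[|t|D _ FD].
- by move=> i _; have [] := cF i.
- by [].
exists (\max_(i <- D) i).+1; apply/seteqP; split=> t; last by move=> [i _ Fi]; exists i.
move=> /FD[i /= iD Fi]; exists i => //=.
by rewrite ltnS; exact: leq_bigmax_seq.
Qed.

Section clopen_measure.
Context {R : realType} {K : ptopologicalType} (L : (K -> R) -> R).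
Hypotheses (Lpos : positive_linear L) (cK : compact [set: K]).

(** [Lpos] and [cK] are arguments so that the measure structure, whose axioms rest on them, can be
    attached to this constant. [functional_charge] and [density_measure] follow the same pattern. *)
Definition clopen_measure (Lpos : positive_linear L) (cK : compact [set: K])
  (A : set (clopen_type K)) : \bar R := (L (\1_A))%:E.

Let m := clopen_measure Lpos cK.

Let m0 : m set0 = 0%E.
Proof. by rewrite /m /clopen_measure indic0 (positive_linear0 Lpos). Qed.

Let m_ge0 A : (0 <= m A)%E.
Proof.
rewrite lee_fin; have [_ _] := Lpos; apply; first exact: bounded_functions_indic.
by move=> t; rewrite indicE ler0n.
Qed.

Let m_additive (F : (set K)^nat) n : trivIset setT F ->
  m (\bigcup_(i < n) F i) = (\sum_(0 <= i < n) m (F i))%E.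
Proof.
move=> tF; elim: n => [|n IH]; first by rewrite big_geq// bigcup_mkord big_ord0.
rewrite big_nat_recr//= -IH bigcup_mkord big_ord_recr/= -bigcup_mkord.
rewrite /m /clopen_measure indic_setU_disjoint; last first.
  apply/seteqP; split=> // t [[i /= ilt Fit] Fnt].
  by move: ilt; rewrite (tF i n I I) ?ltnn//; exists t.
by have [->] := Lpos => //; exact: bounded_functions_indic.
Qed.

Let m_sigma_additive : semi_sigma_additive m.
Proof.
move=> F mF tF mU.
have [n Fn] := clopen_decreasing_cover cK mF mU.
apply: cvg_near_cst; exists n => // k /= nk.
rewrite -m_additive// Fn; congr m; apply/seteqP; split=> t [i /= ik Fit].
  suff : (\bigcup_(i < n) F i) t by [].
  by rewrite -Fn; exists i.
by exists i => //=; exact: leq_trans nk.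
Qed.

HB.instance Definition _ := isMeasure.Build _ _ _ (clopen_measure Lpos cK)
  m0 m_ge0 m_sigma_additive.

End clopen_measure.

Lemma countable_bigcup_measurable d (T : sigmaRingType d) U (D : set U)
    (F : U -> set T) : countable D -> (forall i, D i -> measurable (F i)) ->
  measurable (\bigcup_(i in D) F i).
Proof.
move=> cD mF; rewrite bigcup_set_type; apply: countable_bigcupT_measurable.
  by rewrite (eq_countable (card_setT D)).
by move=> i; apply: mF; exact: set_valP.
Qed.

Section clopen_riesz.
Context {R : realType} {K : ptopologicalType} (L : (K -> R) -> R).
Hypotheses (Lpos : positive_linear L) (cK : compact [set: K]).
Hypotheses (hK : hausdorff_space K) (zK : zero_dimensional K).

Notation sigma_clopen := (g_sigma_algebraType (@measurable _ (clopen_type K))).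

Definition clopen_extension : set sigma_clopen -> \bar R :=
  measure_extension (clopen_measure Lpos cK).

HB.instance Definition _ := Measure.on clopen_extension.

Let lam := clopen_extension.

Lemma clopen_extensionE A : clopen A -> lam A = (L (\1_A))%:E.
Proof.
move=> cA.
by rewrite /lam /clopen_extension /measure_extension measurable_mu_extE.
Qed.

Lemma clopen_extension_setT : lam setT = (L (\1_setT))%:E.
Proof. by apply: clopen_extensionE; exact: clopenT. Qed.

Let lam_fin : fin_num_fun lam.
Proof.
move=> A mA; rewrite ge0_fin_numE//.
rewrite (@le_lt_trans _ _ (lam setT))// ?le_measure ?inE//.
by rewrite clopen_extension_setT ltry.
Qed.

HB.instance Definition _ := Measure_isFinite.Build _ _ _ clopen_extension lam_fin.

Lemma clopen_nbhs (x : K) U : nbhs x U -> exists C, [/\ clopen C, C x & C `<=` U].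
Proof.
by move=> /(zero_dimensional_cvg hK zK cK)[C [Cx cC] CU]; exists C; split.
Qed.

Lemma clopen_measurable (C : set sigma_clopen) : clopen C -> measurable C.
Proof. by move=> cC; exact: sub_sigma_algebra. Qed.

(** Compactness and second countability leave only countably many clopen sets, and an open set is
    the union of those it contains. *)
Lemma open_sigma_clopen (sK : @second_countable K) (U : set sigma_clopen) :
  open (U : set K) -> measurable U.
Proof.
move=> oU; have cc := clopen_countable cK sK.
have -> : U = \bigcup_(C in [set C : set K | clopen C /\ C `<=` U]) C.
  apply/seteqP; split=> [x Ux|x [C [_]]]; last exact.
  by have [C [cC Cx CU]] := clopen_nbhs (open_nbhs_nbhs (conj oU Ux)); exists C.
apply: countable_bigcup_measurable => [|C [cC _]]; last exact: clopen_measurable.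
by apply: sub_countable cc; apply: subset_card_le => C [].
Qed.

Lemma continuous_sigma_clopen (sK : @second_countable K) (g : K -> R) :
  continuous g -> measurable_fun [set: sigma_clopen] g.
Proof.
move=> /continuousP cg; apply: (measurability (@RGenOpens.G R)).
  exact: RGenOpens.measurableE.
move=> _ [_ [a [b ->]] <-]; rewrite setTI; apply: open_sigma_clopen => //.
by apply: cg; exact: interval_open.
Qed.

Lemma compact_bounded_functions (T : topologicalType) (g : T -> R) :
  compact [set: T] -> continuous g -> bounded_functions g.
Proof.
move=> cT cg; have : compact (g @` setT).
  by apply: continuous_compact => //; exact: continuous_subspaceT.
move=> /compact_bounded[M [_ MP]]; exists (M + 1) => t.
by apply: (MP (M + 1)) => //; rewrite ltrDl.
Qed.

Lemma clopen_extension_integrable (sK : @second_countable K) (g : K -> R) C :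
  continuous g -> clopen C -> lam.-integrable C (EFin \o g).
Proof.
move=> cg cC; have [M gM] := compact_bounded_functions cK cg.
apply: (integrableS measurableT) => //; first exact: clopen_measurable.
apply: (@le_integrable _ _ _ lam _ measurableT _ (EFin \o cst M)).
- by apply/measurable_EFinP; exact: (continuous_sigma_clopen sK cg).
- move=> x _ /=; rewrite lee_fin (le_trans (gM x))//; exact: ler_norm.
- exact: finite_measure_integrable_cst.
Qed.

(** Both terms are within [e * L \1_C] of [c * L \1_C], hence the factor [2]. *)
Let oscillation_bound e c (g : K -> R) C (sK : @second_countable K) :
  continuous g -> clopen C ->
  (forall x, C x -> `|g x - c| <= e) ->
  `|\int[lam]_(x in C) g x - L (g * \1_C)| <= 2 * e * L (\1_C).
Proof.
move=> cg cC gc; have mC := clopen_measurable cC.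
have Bg := compact_bounded_functions cK cg.
have BC : bounded_functions (\1_C : K -> R) by exact: bounded_functions_indic.
have [LD LZ _] := Lpos.
have lamC : fine (lam C) = L \1_C by rewrite clopen_extensionE.
have ig : lam.-integrable C (EFin \o g) by exact: clopen_extension_integrable.
have ic k : lam.-integrable C (EFin \o cst k).
  exact: finite_measure_integrable_cst.
have igc : lam.-integrable C (EFin \o (fun x => g x - c)).
  apply: eq_integrable (integrableB mC ig (ic c)) => //.
have -> : \int[lam]_(x in C) g x =
    \int[lam]_(x in C) (g x - c) + c * L \1_C.
  rewrite RintegralB//; last exact: ic.
  by rewrite Rintegral_cst// lamC subrK.
have -> : g * \1_C = (g - cst c) * \1_C + c *: \1_C :> (K -> R).
  apply/funext => x.
  rewrite -[LHS]/(g x * \1_C x) -[RHS]/((g x - c) * \1_C x + c * \1_C x).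
  by rewrite mulrBl subrK.
rewrite LD ?LZ//; last 2 first.
- apply: bounded_functionsM => //; rewrite -scaleN1r.
  apply: bounded_functionsD => //; apply: bounded_functionsZ.
  exact: bounded_functions_cst.
- exact: bounded_functionsZ.
rewrite opprD addrACA subrr addr0 (le_trans (ler_normB _ _))//.
rewrite -mulrA mulr_natl mulr2n lerD//.
  rewrite (le_trans (le_normr_Rintegral _ _))//.
  rewrite -lamC -Rintegral_cst// le_Rintegral//.
  - exact: (integrable_norm igc).
  - exact: ic.
rewrite -LZ//; apply: positive_linear_norm => //.
- apply: bounded_functionsM => //; rewrite -scaleN1r.
  apply: bounded_functionsD => //; apply: bounded_functionsZ.
  exact: bounded_functions_cst.
- exact: bounded_functionsZ.
move=> x; rewrite -[leRHS]/(e * \1_C x) -[X in `|X|]/((g x - c) * \1_C x) !indicE.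
have [/set_mem Cx|_] := boolP (x \in C); last by rewrite !mulr0 normr0.
by rewrite !mulr1 gc.
Qed.

Theorem clopen_riesz (sK : @second_countable K) (g : K -> R) : continuous g ->
  \int[lam]_x g x = L g.
Proof.
move=> cg; have [LD LZ L0] := Lpos.
have Bg := compact_bounded_functions cK cg.
have LT0 : 0 <= L (\1_setT).
  by apply: L0 => [|t]; [exact: bounded_functions_indic|rewrite indicE ler0n].
suff close e : 0 < e ->
    `|\int[lam]_x g x - L (g * \1_setT)| <= 2 * e * L (\1_setT).
  have -> : g = g * \1_setT by apply/funext => x; rewrite fctE /= indicT mulr1.
  have -> : \int[lam]_x ((g * \1_setT) x) = \int[lam]_x g x.
    by apply: eq_Rintegral => x _; rewrite fctE /= indicT mulr1.
  apply/eqP; rewrite -subr_eq0 -normr_le0; apply/ler_addgt0Pl => e e0.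
  have d0 : 0 < e / (2 * (L (\1_setT) + 1)).
    by rewrite divr_gt0// mulr_gt0// ltr_wpDl.
  rewrite addr0 (le_trans (close _ d0))//.
  have l0 : 0 < L \1_setT + 1 by rewrite ltr_wpDl.
  rewrite [leLHS](_ : _ = e * L \1_setT / (L \1_setT + 1)).
    by rewrite ler_pdivrMr// ler_pM2l// lerDl.
  by field; rewrite gt_eqF.
move=> e0.
have [U UP] : exists U : K -> set K, forall x, [/\ clopen (U x), U x x &
    forall y, U x y -> `|g y - g x| <= e].
  have /choice : forall x, exists U : set K, [/\ clopen U, U x &
      forall y, U y -> `|g y - g x| <= e].
    move=> x; have /cvgrPdist_le /(_ _ e0) gx := cg x.
    have [C [cC Cx CU]] := clopen_nbhs gx; exists C; split => // y /CU.
    by rewrite /= distrC.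
  by move=> [U UP]; exists U => x; exact: UP.
(* Induction over the centres of a finite cover, for all clopen [C] at once: removing [U y] from [C]
   leaves a clopen set covered by the remaining centres. The pieces are disjoint, so their errors
   add up to one multiple of [L \1_C], whatever their number. *)
have H (s : seq K) : forall C, clopen C ->
    (forall x, C x -> exists2 y, y \in s & U y x) ->
    `|\int[lam]_(x in C) g x - L (g * \1_C)| <= 2 * e * L (\1_C).
  elim: s => [|y s IH] C cC Cs.
    apply: (@oscillation_bound e 0) => // x /Cs[y].
    by rewrite in_nil.
  have [cU Uy gU] := UP y.
  have cCU : clopen (C `&` U y) by exact: clopenI.
  have cCD : clopen (C `\` U y) by rewrite setDE; apply: clopenI => //; exact: clopenC.
  have CE : C = (C `&` U y) `|` (C `\` U y) by rewrite setUIDK.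
  have I0 : (C `&` U y) `&` (C `\` U y) = set0.
    by apply/seteqP; split=> // x [[_ ?] [_ ?]].
  have BU A : bounded_functions (\1_A : K -> R) by exact: bounded_functions_indic.
  rewrite [in X in X <= _]CE [in leRHS]CE indic_setU_disjoint// LD// mulrDr LD; last 2 first.
    exact: bounded_functionsM.
    exact: bounded_functionsM.
  rewrite Rintegral_setU//; last 4 first.
  - exact: clopen_measurable.
  - exact: clopen_measurable.
  - by rewrite -CE; exact: clopen_extension_integrable.
  - exact/disj_set2P.
  rewrite opprD addrACA mulrDr (le_trans (ler_normD _ _))// lerD//.
    by apply: (@oscillation_bound e (g y)) => // x [_ /gU].
  apply: IH => // x [Cx Ux]; have [z] := Cs _ Cx.
  rewrite in_cons => /predU1P[->//|zs Uz]; by exists z.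
have : compact [set: K] by [].
rewrite compact_cover => /(_ K setT U)[x _|x _|D _ DU].
- by have [[]] := UP x.
- by exists x => //; have [] := UP x.
apply: (H (enum_fset D)) => [|x _]; first exact: clopenT.
by have [y /= yD Uy] := DU x I; exists y.
Qed.

(* Outer regularity is built into the extension, whose value at a set is the
   infimum over its countable covers by clopen sets. *)
Lemma clopen_extension_regular (A : set sigma_clopen) e : measurable A ->
  0 < e -> exists C : set K, [/\ closed C, C `<=` A &
    (lam A <= lam (C : set sigma_clopen) + e%:E)%E].
Proof.
move=> mA e0; have mAC : measurable (~` A) by exact: measurableC.
have : (ereal_inf [set (\sum_(k <oo) clopen_measure Lpos cK (B k))%E | B in
    @measurable_cover _ (clopen_type K) (~` A)] < lam (~` A) + e%:E)%E.
  rewrite -/(mu_ext _ _) -[X in (X < _)%E]/(lam (~` A)).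
  by rewrite lteDl ?lte_fin// fin_num_measure.
move=> /ereal_inf_lt[_ [B [mB AB] <-]] Be.
have cB k : clopen (B k) by exact: mB.
pose O : set K := \bigcup_k B k.
have mO : measurable (O : set sigma_clopen).
  by apply: bigcup_measurable => k _; exact: clopen_measurable.
exists (~` O); split.
- apply: open_closedC; apply: bigcup_open => k _; by have [] := cB k.
- by move=> x nOx; apply: contrapT => nAx; apply: nOx; exact: AB.
have lamO : (lam O <= lam (~` A) + e%:E)%E.
  rewrite (le_trans _ (ltW Be))//.
  rewrite (@eq_eseriesr _ _ (lam \o B)); last first.
    by move=> k _; rewrite /= clopen_extensionE.
  apply: measure_sigma_subadditive => //; first by move=> k; exact: clopen_measurable.
have fA : lam A \is a fin_num by exact: lam_fin.
have fO : lam (O : set sigma_clopen) \is a fin_num by exact: lam_fin.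
have fT : lam setT \is a fin_num by exact: lam_fin.
have eqC (B' : set sigma_clopen) : measurable B' -> lam (~` B') = (lam setT - lam B')%E.
  move=> mB'; rewrite -setTD [LHS](@measureD _ _ _ clopen_extension _ _ measurableT mB').
    by rewrite setTI.
  by rewrite -ge0_fin_numE.

move: lamO; rewrite (eqC A mA) (eqC O mO).
rewrite -(fineK fA) -(fineK fO) -(fineK fT) -!EFinB -!EFinD !lee_fin; lra.
Qed.

End clopen_riesz.

(* [tree_of] carries the pseudometric that [cantor_space] lacks. *)
Lemma cantor_space_second_countable (R : realType) :
  @second_countable cantor_space.
Proof.
exact: (@compact_second_countable R (@tree_of (fun=> bool : pointedType))
  cantor_space_compact).
Qed.

Section image_measure.
Context d d' (X : measurableType d) (Y : measurableType d') (R : realType).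
Variables (m : {finite_measure set X -> \bar R}) (f : {mfun X >-> Y}).

Definition image_measure : set Y -> \bar R := pushforward m f.

Let image_measure0 : image_measure set0 = 0%E.
Proof. exact: measure0. Qed.

Let image_measure_ge0 A : (0 <= image_measure A)%E.
Proof. exact: measure_ge0. Qed.

Let image_measure_sigma_additive : semi_sigma_additive image_measure.
Proof. exact: measure_semi_sigma_additive. Qed.

HB.instance Definition _ := isMeasure.Build _ _ _ image_measure
  image_measure0 image_measure_ge0 image_measure_sigma_additive.

Let image_measure_fin : fin_num_fun image_measure.
Proof.
move=> A mA; apply: fin_num_measure.
by rewrite -[X in measurable X]setTI; exact: measurable_funP.
Qed.

HB.instance Definition _ :=
  Measure_isFinite.Build _ _ _ image_measure image_measure_fin.

End image_measure.

Lemma continuous_borel_measurable (R : realType) (T : ptopologicalType)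
  (f : T -> R) : continuous f -> measurable_fun [set: borel T] f.
Proof.
move=> cf; apply: (measurability (@RGenOpens.G R)).
  exact: RGenOpens.measurableE.
move=> _ [_ [a [b ->]] <-]; rewrite setTI; apply: sub_sigma_algebra.
by move/continuousP : cf; apply; exact: interval_open.
Qed.

Section riesz.
Context {R : realType} {T : pmetricType R} (cT : compact [set: T]).
Context (L : (T -> R) -> R) (Lpos : positive_linear L).

Lemma compact_continuous_integrable (m : {finite_measure set (borel T) -> \bar R})
  (y : T -> R) : continuous y -> m.-integrable setT (EFin \o y).
Proof.
move=> cy; have [M yM] := compact_bounded_functions cT cy.
apply: (@le_integrable _ _ _ m _ measurableT _ (EFin \o cst M)).
- by apply/measurable_EFinP; exact: continuous_borel_measurable.
- by move=> x _ /=; rewrite lee_fin (le_trans (yM x))// ler_norm.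
- exact: finite_measure_integrable_cst.
Qed.

(* The functional is transported to the Cantor space along a section of a
   continuous surjection onto [T]. *)
Theorem riesz : exists2 m : {finite_measure set (borel T) -> \bar R},
  radon m & forall y, continuous y -> \int[m]_x y x = L y.
Proof.
pose K : ptopologicalType := cantor_space.
have [pi cpi] := @cantor_surj R T cT (@metric_hausdorff R T).
have [s spi] : exists s : T -> K, cancel s pi.
  have /choice[s sP] : forall t, exists k, pi k = t.
    by move=> t; have [k _ kt] := @surj _ _ _ _ pi t I; exists k.
  by exists s.
pose LK (g : K -> R) := L (g \o s).
have BK (g : K -> R) : bounded_functions g -> bounded_functions (g \o s).
  by move=> [M gM]; exists M => t; exact: gM.
have LKpos : positive_linear LK.
  have [LD LZ L0] := Lpos; split.
  - by move=> f g Bf Bg; rewrite -LD//; exact: BK.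
  - by move=> c f Bf; rewrite -LZ//; exact: BK.
  - by move=> f Bf f0; apply: L0 => [|t]; [exact: BK|exact: f0].
have cK : compact [set: K] := cantor_space_compact.
have hK : hausdorff_space K := cantor_space_hausdorff.
have zK : zero_dimensional K := cantor_zero_dimensional.
have sK : @second_countable K := @cantor_space_second_countable R.
pose lam := clopen_extension LKpos cK.
pose X := g_sigma_algebraType (@measurable _ (clopen_type K)).
have mpi : measurable_fun [set: X] (pi : X -> borel T).
  apply: (@measurability _ _ X (borel T) setT pi (@open T)) => // _ [U oU <-].
  rewrite setTI; apply: open_sigma_clopen => //.
  by apply: open_comp => // x _; exact: cpi.
pose f : {mfun X >-> borel T} := mfun_Sub (mem_set mpi).
pose m := image_measure lam f.
exists m.
  move=> A mA; apply/eqP; rewrite eq_le; apply/andP; split; last first.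
    apply: ge_ereal_sup => _ [C [cC CA] <-]; apply: le_measure => //; rewrite inE//.
    have : closed (C : set T) by apply: compact_closed => //; exact: metric_hausdorff.
    move=> /closed_openC oC; rewrite -[C]setCK; apply: measurableC.
    exact: sub_sigma_algebra.
  apply/lee_addgt0Pr => e e0.
  have mfA : measurable ((f : X -> borel T) @^-1` A).
    by rewrite -[X in measurable X]setTI; exact: measurable_funP.
  (* The closed set [C] of the Cantor space is compact. Its image is a compact subset of [A] whose
     preimage contains [C], hence has at least the measure of [C]. *)
  have [C [cC CA lamC]] := clopen_extension_regular LKpos cK mfA e0.
  rewrite (le_trans lamC)// leeD2r//.
  have cC' : compact (C : set K) by exact: (subclosed_compact cC cK).
  have cpC : compact (pi @` C).
    apply: continuous_compact => //; apply: continuous_subspaceT => x; exact: cpi.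
  have mpC : measurable (pi @` C : set (borel T)).
    have : closed (pi @` C) by apply: compact_closed => //; exact: metric_hausdorff.
    move=> /closed_openC oC; rewrite -[X in measurable X]setCK; apply: measurableC.
    exact: sub_sigma_algebra.
  apply: (@le_trans _ _ (m (pi @` C))); last first.
    by apply: ereal_sup_ubound; exists (pi @` C) => //; split=> // _ [x /CA Ax <-].
  apply: le_measure; rewrite ?inE.
  - rewrite -[X in measurable X]setCK; apply: measurableC.
    by apply: open_sigma_clopen => //; exact: closed_openC.
  - by rewrite -[X in measurable X]setTI; exact: measurable_funP.
  - by move=> x Cx; exists x.
move=> y cy.
have -> : L y = LK (y \o pi).
  by congr L; apply/funext => t /=; rewrite spi.
have cyp : continuous (y \o pi).
  by move=> x; apply: continuous_comp; [exact: cpi|exact: cy].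
rewrite -(clopen_riesz LKpos cK hK zK sK cyp).
congr fine; have := @integral_pushforward _ _ X (borel T) R f (measurable_funP f) lam setT
  (EFin \o y).
rewrite preimage_setT; apply => //.
- exact: (measurable_int m (compact_continuous_integrable m cy)).
- exact: (clopen_extension_integrable LKpos cK hK zK sK cyp clopenT).
Qed.

End riesz.

(** * Duality of L1 and bounded functions *)

Notation Rintegrable mu f := (mu.-integrable setT (EFin \o f)).

Section integrable_real.
Context d (X : measurableType d) (R : realType).
Variable mu : {measure set X -> \bar R}.
Implicit Types (f g h u : X -> R).

Lemma Rintegrable_measurable f : Rintegrable mu f -> measurable_fun setT f.
Proof. by move=> /measurable_int /measurable_EFinP. Qed.

Lemma RintegrableD f g : Rintegrable mu f -> Rintegrable mu g ->
  Rintegrable mu (f + g).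
Proof. by move=> If Ig; exact: (integrableD measurableT If Ig). Qed.

Lemma RintegrableB f g : Rintegrable mu f -> Rintegrable mu g ->
  Rintegrable mu (fun x => f x - g x).
Proof. by move=> If Ig; exact: (integrableB measurableT If Ig). Qed.

Lemma RintegrableZ c f : Rintegrable mu f -> Rintegrable mu (c *: f).
Proof. by move=> If; exact: (integrableZl measurableT c If). Qed.

Lemma le_Rintegrable f g : measurable_fun setT f ->
  (forall x, `|f x| <= g x) -> Rintegrable mu g -> Rintegrable mu f.
Proof.
move=> mf fg; apply: le_integrable => //; first exact/measurable_EFinP.
by move=> x _ /=; rewrite lee_fin (le_trans (fg x))// ler_norm.
Qed.

Lemma RintegrableM h f c : measurable_fun setT h ->
  (forall x, `|h x| <= c) -> Rintegrable mu f -> Rintegrable mu (h * f).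
Proof.
move=> mh hc If; apply: (@le_Rintegrable _ (fun x => c * `|f x|)).
- by apply: measurable_funM => //; exact: Rintegrable_measurable.
- by move=> x; rewrite -[(h * f) x]/(h x * f x) normrM ler_wpM2r.
- exact: (RintegrableZ c (integrable_norm If)).
Qed.

End integrable_real.

Section L1_dual.
Context d (X : measurableType d) (R : realType).
Variable mu : {finite_measure set X -> \bar R}.
Variable l : (X -> R) -> R.
Hypothesis lD : forall u v, Rintegrable mu u -> Rintegrable mu v ->
  l (u + v) = l u + l v.
Hypothesis lZ : forall c u, Rintegrable mu u -> l (c *: u) = c * l u.
Hypothesis l_le : forall u, Rintegrable mu u -> `|l u| <= \int[mu]_x `|u x|.

Let integrable_indicT A : measurable A -> Rintegrable mu (\1_A : X -> R).
Proof. exact: integrable_indic. Qed.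

Let int_indic A : measurable A -> (\int[mu]_x (\1_A x : R))%R = fine (mu A).
Proof. by move=> mA; rewrite /Rintegral integral_indic// setIT. Qed.

Let kappa A : \bar R := (l (\1_A))%:E.

Let l0 : l (cst 0) = 0.
Proof.
have := lZ 0 (integrable_indicT measurable0).
by rewrite scale0r mul0r.
Qed.

Let kappa0 : kappa set0 = 0%E.
Proof. by rewrite /kappa indic0 l0. Qed.

Let kappa_fin A : measurable A -> kappa A \is a fin_num.
Proof. by []. Qed.

Let l_additive (F : (set X)^nat) n : (forall i, measurable (F i)) ->
  trivIset setT F ->
  l (\1_(\bigcup_(i < n) F i)) = \sum_(0 <= i < n) l (\1_(F i)).
Proof.
move=> mF tF; elim: n => [|n IH].
  by rewrite big_geq// bigcup_mkord big_ord0 indic0 l0.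
rewrite big_nat_recr//= -IH -lD; last 2 first.
- by apply: integrable_indicT; apply: bigcup_measurable.
- exact: integrable_indicT.
congr l; apply/funext => t.
rewrite bigcup_mkord big_ord_recr/= -bigcup_mkord.
rewrite -[RHS]/(\1_(\bigcup_(i < n) F i) t + \1_(F n) t) !indicE in_setU.
have [Ft|Ft] := boolP (t \in F n); last by rewrite orbF addr0.
rewrite orbT memNset ?add0r// => -[i /= ilt Fit].
by move: ilt; rewrite (tF i n I I) ?ltnn//; exists t; split => //; exact: set_mem.
Qed.

(** The error after [n] terms is [l] at the indicator of the rest of the union. It is at most the
    [mu]-measure of that rest, which tends to [0]. *)
Let kappa_sigma_additive : semi_sigma_additive kappa.
Proof.
move=> F mF tF mU.
have mUn n : measurable (\bigcup_(i < n) F i) by exact: bigcup_measurable.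
have mD n : measurable (\bigcup_i F i `\` \bigcup_(i < n) F i) by exact: measurableD.
have sub n : \bigcup_(i < n) F i `<=` \bigcup_i F i by move=> t [i _ Fit]; exists i.
have lB n : `|l (\1_(\bigcup_i F i)) - l (\1_(\bigcup_(i < n) F i))| <=
    fine (mu (\bigcup_i F i)) - fine (mu (\bigcup_(i < n) F i)).
  have -> : \1_(\bigcup_i F i) =
      \1_(\bigcup_i F i `\` \bigcup_(i < n) F i) + \1_(\bigcup_(i < n) F i) :> (X -> R).
    apply/funext => t.
    rewrite -[RHS]/(\1_(_ `\` _) t + \1_(\bigcup_(i < n) F i) t) !indicE.
    rewrite in_setD; have [Ft|Ft] := boolP (t \in \bigcup_(i < n) F i).
      by rewrite mem_set/= ?add0r//; apply: (sub n); exact: set_mem.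
    by rewrite andbT addr0.
  rewrite lD ?addrK; [|exact: integrable_indicT..].
  rewrite (le_trans (l_le (integrable_indicT (mD n))))//.
  under eq_Rintegral do rewrite ger0_norm ?indicE//.
  rewrite [leLHS](_ : _ =
    \int[mu]_x (\1_(\bigcup_i F i `\` \bigcup_(i < n) F i) x : R)) //.
  rewrite int_indic// measureD//; last by rewrite -ge0_fin_numE// fin_num_measure.
  by rewrite setIidr// fineB// fin_num_measure.
have cm : fine (mu (\bigcup_(i < n) F i)) @[n --> \oo] --> fine (mu (\bigcup_i F i)).
  apply: fine_cvg; rewrite fineK ?fin_num_measure//.
  rewrite (_ : (fun n => _) = (fun n => \sum_(0 <= i < n) mu (F i))%E).
    exact: measure_semi_sigma_additive.
  by apply/funext => n; rewrite bigcup_mkord measure_bigsetU// big_mkord.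
rewrite [X in X @ _ --> _](_ : _ =
    (fun n => (l (\1_(\bigcup_(i < n) F i)))%:E)); last first.
  by apply/funext => n; rewrite l_additive// -sumEFin.
apply: cvg_EFin; first exact: nearW.
apply/cvgrPdist_le => /= e e0; move/cvgrPdist_le : cm => /(_ e e0).
apply: filterS => n /=; apply: le_trans; apply: le_trans (lB n) _.
exact: ler_norm.
Qed.

Definition functional_charge
  (_ : forall u v, Rintegrable mu u -> Rintegrable mu v -> l (u + v) = l u + l v)
  (_ : forall c u, Rintegrable mu u -> l (c *: u) = c * l u)
  (_ : forall u, Rintegrable mu u -> `|l u| <= \int[mu]_x `|u x|) :
  set X -> \bar R := kappa.
HB.instance Definition _ := isCharge.Build _ _ _ (functional_charge lD lZ l_le)
  kappa0 kappa_fin kappa_sigma_additive.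

End L1_dual.

Section L1_dual_theorem.
Context d (X : measurableType d) (R : realType).
Variable mu : {finite_measure set X -> \bar R}.
Implicit Types (u v h : X -> R).
Import HBSimple.
Local Open Scope charge_scope.

Lemma Rintegral_indicM u A : measurable A ->
  \int[mu]_x (u x * \1_A x) = \int[mu]_(x in A) u x.
Proof.
move=> mA; rewrite [RHS]Rintegral_mkcond; apply: eq_Rintegral => x _.
by rewrite patchE indicE; case: (x \in A); rewrite (mulr1, mulr0).
Qed.

Lemma ge0_Rintegral_eq0 u : Rintegrable mu u -> (forall x, 0 <= u x) ->
  \int[mu]_x u x <= 0 -> ae_eq mu setT u (cst 0).
Proof.
move=> Iu u0 Iu0; have mu0 : measurable_fun setT (EFin \o u).
  exact: measurable_int Iu.
have /(ae_eq_integral_abs _ measurableT mu0) : (\int[mu]_x `|(EFin \o u) x| = 0)%E.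
  under eq_integral do rewrite /= ger0_norm//.
  rewrite -(fineK (integrable_fin_num measurableT Iu)); congr EFin.
  by apply/eqP; rewrite eq_le Iu0 Rintegral_ge0.
by apply: filterS => x /= /(_ I)[->].
Qed.

Lemma ae_eq_Rintegral u v : measurable_fun setT u -> measurable_fun setT v ->
  ae_eq mu setT u v -> \int[mu]_x u x = \int[mu]_x v x.
Proof.
move=> mfu mfv uv; congr fine; apply: ae_eq_integral => //.
- exact/measurable_EFinP.
- exact/measurable_EFinP.
- by apply: filterS uv => x /= /(_ I) ->.
Qed.

(* The density of the charge [A |-> l \1_A]. *)
Theorem L1_dual (l : (X -> R) -> R) :
  (forall u v, Rintegrable mu u -> Rintegrable mu v -> l (u + v) = l u + l v) ->
  (forall c u, Rintegrable mu u -> l (c *: u) = c * l u) ->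
  (forall u, Rintegrable mu u -> `|l u| <= \int[mu]_x `|u x|) ->
  exists h, [/\ measurable_fun setT h, forall x, `|h x| <= 1 &
    forall u, Rintegrable mu u -> l u = \int[mu]_x (h x * u x)].
Proof.
move=> lD lZ l_le; pose k := functional_charge lD lZ l_le.
have Iind A : measurable A -> Rintegrable mu (\1_A : X -> R).
  exact: integrable_indic.
have k_mu : k `<< mu.
  apply/null_content_dominatesP => A mA A0; rewrite -[LHS]/((l (\1_A))%:E).
  congr EFin; apply/eqP; rewrite -normr_le0 (le_trans (l_le _ (Iind _ mA)))//.
  under eq_Rintegral do rewrite ger0_norm ?indicE//.
  rewrite [leLHS](_ : _ = \int[mu]_x (\1_A x : R))//.
  rewrite /Rintegral integral_indic// setIT le_eqVlt; apply/orP; left; apply/eqP.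
  exact: (congr1 fine A0).
pose h0 := fine \o ('d k '/d mu).
have Ih0 : Rintegrable mu h0.
  apply: eq_integrable (Radon_Nikodym_integrable k_mu) => // x _.
  by rewrite /h0 /= fineK// Radon_Nikodym_fin_num.
have mh0 := Rintegrable_measurable Ih0.
have h0E A : measurable A -> l (\1_A) = \int[mu]_(x in A) h0 x.
  move=> mA; apply: EFin_inj.
  have -> : (l (\1_A))%:E = (\int[mu]_(x in A) ('d k '/d mu) x)%E.
    exact: (Radon_Nikodym_integral k_mu mA).
  rewrite fineK; last by apply: integrable_fin_num => //; exact: integrableS Ih0.
  by apply: eq_integral => x _; rewrite /h0 /= fineK// Radon_Nikodym_fin_num.
have lA A : measurable A -> `|\int[mu]_(x in A) h0 x| <= \int[mu]_(x in A) 1.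
  move=> mA; rewrite -h0E// (le_trans (l_le _ (Iind _ mA)))//.
  rewrite [leRHS]Rintegral_mkcond.
  rewrite [leLHS](@eq_Rintegral _ _ _ _ _ ((cst 1 : X -> R) \_ A))// => x _.
  by rewrite patchE indicE; case: (x \in A); rewrite (normr1, normr0).
(* [h0] is bounded by [1] only almost everywhere; truncation makes the bound hold everywhere. *)
pose h x := Num.max (-1) (Num.min (h0 x) 1).
have mh : measurable_fun setT h.
  by apply: measurable_maxr => //; exact: measurable_minr.
have h1 x : `|h x| <= 1.
  rewrite /h ler_norml le_max lexx/= ge_max ge_min lexx orbT andbT; lra.
have hh0 : ae_eq mu setT h0 h.
  (* On the set where [f > 1], the function [f - 1] is positive but has integral at most [0], so
     this set is negligible. Applied to [h0] and to its opposite. *)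
  have pos (f : X -> R) : Rintegrable mu f ->
      (forall A, measurable A -> \int[mu]_(x in A) f x <= \int[mu]_(x in A) 1) ->
      ae_eq mu setT (fun x => Num.max (f x - 1) 0) (cst 0).
    move=> If fA; pose A := [set x | 1 < f x].
    have mf := Rintegrable_measurable If.
    have mA : measurable A.
      rewrite -[A]setTI; have -> : A = f @^-1` `]1, +oo[.
        by apply/seteqP; split => x /=; rewrite in_itv/= andbT.
      exact: mf.
    have I1 : mu.-integrable A (EFin \o cst 1) by exact: finite_measure_integrable_cst.
    have IfA : mu.-integrable A (EFin \o f) by exact: integrableS If.
    have mE : (fun x => Num.max (f x - 1) 0) = ((fun x => f x - 1) : X -> R) \_ A.
      apply/funext => x; rewrite patchE; have [/set_mem|] := boolP (x \in A).
        by move=> fx; rewrite max_l// subr_ge0 ltW.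
      move=> /negP fx; rewrite max_r// subr_le0 leNgt; apply/negP => f1.
      by apply: fx; rewrite inE.
    apply: ge0_Rintegral_eq0.
    - apply: (@le_Rintegrable _ _ _ _ _ (fun x => `|f x| + 1)).
      + by apply: measurable_maxr => //; exact: measurable_funB.
      + move=> x; rewrite ger0_norm ?le_max ?lexx ?orbT// ge_max addr_ge0// andbT.
        by have := ler_norm (f x); lra.
      + apply: (RintegrableD (integrable_norm If)).
        exact: finite_measure_integrable_cst.
    - by move=> x; rewrite le_max lexx orbT.
    - by rewrite mE -Rintegral_mkcond RintegralB// subr_le0 fA.
  have hp := pos _ Ih0 (fun A mA => le_trans (ler_norm _) (lA A mA)).
  have hn : ae_eq mu setT (fun x => Num.max (- h0 x - 1) 0) (cst 0).
    apply: (pos (fun x => - h0 x)) => [|A mA].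
      have := RintegrableZ (-1) Ih0; apply: eq_integrable => // x _.
      by rewrite /= -[(_ *: _) x]/(-1 * h0 x) mulN1r.
    under eq_Rintegral do rewrite -mulN1r.
    rewrite RintegralZl//; last exact: integrableS Ih0.
    by rewrite mulN1r (le_trans (ler_norm _))// normrN lA.
  apply: filterS2 hp hn => x /(_ I) /= hp /(_ I) /= hn _; rewrite /h.
  have p1 : h0 x <= 1 by rewrite -subr_le0 -hp le_max lexx.
  have n1 : - h0 x <= 1 by rewrite -subr_le0 -hn le_max lexx.
  by rewrite min_l// max_r// lerNl.
have Ih u : Rintegrable mu u -> Rintegrable mu (h * u).
  by move=> Iu; exact: (RintegrableM mh h1).
exists h; split => //.
(* The formula is linear in [u] and holds for indicators, hence for simple functions. Both sides are
   Lipschitz for the [L^1] norm with constant [1], which accounts for the [2] in [bound] below. *)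
pose Q u := Rintegrable mu u /\ l u = \int[mu]_x (h x * u x).
have Q0 : Q (cst 0).
  have I0 : Rintegrable mu (cst 0) by exact: finite_measure_integrable_cst.
  split => //; have := lZ 0 _ I0; rewrite scale0r mul0r => ->.
  by under eq_Rintegral do rewrite mulr0; rewrite Rintegral_cst// mul0r.
have QD u v : Q u -> Q v -> Q (u + v).
  move=> [Iu lu] [Iv lv]; split; first exact: RintegrableD.
  rewrite lD// lu lv -RintegralD; [|by []|exact: Ih..].
  by apply: eq_Rintegral => x _; rewrite -mulrDr.
have QZ c u : Q u -> Q (c *: u).
  move=> [Iu lu]; split; first exact: RintegrableZ.
  rewrite lZ// lu -RintegralZl//; last exact: Ih.
  by apply: eq_Rintegral => x _; rewrite mulrCA.
have QI A : measurable A -> Q (\1_A).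
  move=> mA; split; first exact: Iind.
  rewrite h0E// -Rintegral_indicM//.
  have m1 : measurable_fun setT (\1_A : X -> R) by exact: measurable_indic.
  apply: ae_eq_Rintegral; [exact: measurable_funM|exact: measurable_funM|].
  by apply: filterS hh0 => x /(_ I) -> _.
have Qs (g : {sfun X >-> R}) : Q g.
  have -> : (g : X -> R) =
      \sum_(y <- fset_set (range g)) (y *: (\1_(g @^-1` [set y]) : X -> R)).
    apply/funext => x; rewrite fct_sumE fimfunE fsbig_finite//=.
  elim/big_ind : _ => // y _; apply: QZ; apply: QI.
  by rewrite -[X in measurable X]setTI; exact: measurable_funP.
move=> u Iu; have [g [Ig _ gu]] := approximation_sfun_integrable measurableT Iu.
have bound n : `|l u - \int[mu]_x (h x * u x)| <= 2 * \int[mu]_x `|u x - g n x|.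
  have [_ lg] := Qs (g n).
  have Iug : Rintegrable mu (fun x => u x - g n x) by exact: RintegrableB (Ig n).
  have -> : l u = l (g n) + l (fun x => u x - g n x).
    rewrite -lD; [|exact: Ig|by []]; congr l; apply/funext => x.
    by rewrite -[RHS]/(g n x + (u x - g n x)) addrC subrK.
  rewrite lg -addrA addrCA -RintegralB; [|by []|exact: Ih (Ig n)|exact: Ih].
  rewrite (le_trans (ler_normD _ _))// mulr_natl mulr2n lerD ?l_le//.
  have Ihh : Rintegrable mu (fun x => h x * g n x - h x * u x).
    by apply: RintegrableB; [exact: Ih (Ig n)|exact: Ih].
  rewrite (le_trans (le_normr_Rintegral measurableT Ihh))//.
  apply: le_Rintegral => //; [exact: (integrable_norm Ihh)|exact: (integrable_norm Iug)|].
  by move=> x _; rewrite -mulrBr normrM distrC ler_piMl.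
have {}gu : \int[mu]_x `|u x - g n x| @[n --> \oo] --> (0 : R).
  exact: (@fine_cvg _ _ _ _ (fun n => \int[mu]_x `|(EFin \o u) x - (g n x)%:E|)%E).
apply/eqP; rewrite -subr_eq0 -normr_le0; apply/ler_addgt0Pl => e e0; rewrite addr0.
have e20 : 0 < e / 2 by rewrite divr_gt0.
move/cvgrPdist_le : gu => /(_ _ e20)[N _ /(_ N (leqnn _))] /=.
rewrite sub0r normrN ger0_norm ?Rintegral_ge0// => gN.
by rewrite (le_trans (bound N))//; lra.
Qed.

(** Hahn-Banach for the [L^1] distance [p] to [M], at the point [G]. The functional obtained
    vanishes on [M] and is bounded by the [L^1] norm, hence is integration against a bounded [h].
    The hypothesis on such [h] makes it vanish at [G], where it equals [p G]. *)
Theorem L1_annihilator (M : set (X -> R)) (G : X -> R) :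
  M (cst 0) -> (forall u v, M u -> M v -> M (u + v)) ->
  (forall c u, M u -> M (c *: u)) -> (forall u, M u -> Rintegrable mu u) ->
  Rintegrable mu G ->
  (forall h c, measurable_fun setT h -> (forall x, `|h x| <= c) ->
    (forall m, M m -> \int[mu]_x (h x * m x) = 0) ->
    \int[mu]_x (h x * G x) = 0) ->
  forall e, 0 < e -> exists2 m, M m & \int[mu]_x `|G x - m x| < e.
Proof.
move=> M0 MD MZ MI IG ann e e0.
pose D u := [set \int[mu]_x `|u x - m x| | m in M].
pose p u := inf (D u).
have D0 u : lbound (D u) 0 by move=> _ [m Mm <-]; exact: Rintegral_ge0.
have hD u : has_inf (D u).
  split; last by exists 0; exact: D0.
  by eexists; exists (cst 0).
have p_le u m : M m -> p u <= \int[mu]_x `|u x - m x|.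
  by move=> Mm; apply: ge_inf; [exact: (hD u).2|exists m].
have Inorm u v : Rintegrable mu u -> Rintegrable mu v ->
    Rintegrable mu (fun x => `|u x - v x|).
  by move=> Iu Iv; exact: (integrable_norm (RintegrableB Iu Iv)).
have ps : sublinear_on [set u : X -> R | Rintegrable mu u] p.
  split.
    move=> u v Iu Iv; rewrite -lerBlDr.
    apply: lb_le_inf => [|_ [m Mm <-]]; first exact: (hD u).1.
    rewrite lerBlDr [leRHS]addrC -lerBlDr.
    apply: lb_le_inf => [|_ [n Mn <-]]; first exact: (hD v).1.
    rewrite lerBlDr [leRHS]addrC (le_trans (p_le _ _ (MD _ _ Mm Mn)))//.
    rewrite -RintegralD; [|by []|exact: Inorm (MI _ Mm)|exact: Inorm (MI _ Mn)].
    apply: le_Rintegral => //.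
    - by apply: Inorm; [exact: RintegrableD|exact: MI (MD _ _ Mm Mn)].
    - exact: (RintegrableD (Inorm _ _ Iu (MI _ Mm)) (Inorm _ _ Iv (MI _ Mn))).
    - move=> x _; rewrite -[(u + v) x]/(u x + v x) -[(m + n) x]/(m x + n x).
      by rewrite opprD addrACA ler_normD.
  have pZ c u : 0 < c -> Rintegrable mu u -> p (c *: u) <= c * p u.
    move=> c0 Iu; rewrite -ler_pdivrMl//.
    apply: lb_le_inf => [|_ [m Mm <-]]; first exact: (hD u).1.
    rewrite ler_pdivrMl// (le_trans (p_le _ _ (MZ c _ Mm)))//.
    rewrite -RintegralZl//; last exact: Inorm (MI _ Mm).
    rewrite le_eqVlt; apply/orP; left; apply/eqP; apply: eq_Rintegral => x _.
    rewrite -[(c *: u) x]/(c * u x) -[(c *: m) x]/(c * m x).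
    by rewrite -mulrBr normrM gtr0_norm.
  move=> c u c0 Iu; apply/eqP; rewrite eq_le pZ//= -ler_pdivlMl//.
  have := pZ c^-1 (c *: u); rewrite scalerA mulVf ?gt_eqF// scale1r.
  by apply; rewrite ?invr_gt0//; exact: RintegrableZ.
have [l [lD lZ lp lG]] := @hahn_banach R (X -> R)%type [set u : X -> R | Rintegrable mu u]
  (@RintegrableD _ _ _ mu) (@RintegrableZ _ _ _ mu) p G ps IG.
have lN u : Rintegrable mu u -> l (- u) = - l u.
  by move=> Iu; rewrite -scaleN1r lZ// mulN1r.
have pn u : p u <= \int[mu]_x `|u x|.
  rewrite (le_trans (p_le _ _ M0))// le_eqVlt; apply/orP; left; apply/eqP.
  by apply: eq_Rintegral => x _; rewrite subr0.
have l_le u : Rintegrable mu u -> `|l u| <= \int[mu]_x `|u x|.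
  move=> Iu; rewrite ler_norml (le_trans (lp _ Iu) (pn _)) andbT lerNl -lN//.
  have INu : Rintegrable mu (- u) by rewrite -scaleN1r; exact: RintegrableZ.
  rewrite (le_trans (lp _ INu))// (le_trans (pn _))//.
  by under eq_Rintegral do rewrite normrN.
have lM m : M m -> l m = 0.
  have pM n : M n -> p n <= 0.
    move=> Mn; rewrite (le_trans (p_le _ _ Mn))//.
    by under eq_Rintegral do rewrite subrr normr0; rewrite Rintegral_cst// mul0r.
  move=> Mm; have := le_trans (lp _ (MI _ Mm)) (pM _ Mm).
  have MNm : M (- m) by rewrite -scaleN1r; exact: MZ.
  have := le_trans (lp _ (MI _ MNm)) (pM _ MNm).
  by rewrite lN ?MI//; lra.
have [h [mh h1 lh]] := L1_dual lD lZ l_le.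
have pG : p G = 0.
  rewrite -lG lh// (ann h 1)// => m Mm; rewrite -lh ?lM//; exact: MI.
have : p G < e by rewrite pG.
move=> /inf_lt[|_ [m Mm <-] ?]; first exact: (hD G).1.
by exists m.
Qed.

End L1_dual_theorem.

(** * Densities and relative entropy *)

Lemma measurable_fun_lne (R : realType) : measurable_fun [set: \bar R] (@lne R).
Proof.
have -> : @lne R = fun x => if (0%:E < x)%E then
    (if (x < +oo)%E then (ln (fine x))%:E else +oo%E) else -oo%E.
  apply/funext => -[r| |] //=; last by rewrite ltry.
  by rewrite lte_fin ltry ltNge; case: (r <= 0).
apply: (@measurable_fun_ifT _ _ (\bar R) (\bar R) _ _ (fun x => (0%:E < x)%E)) => //=.
  apply: (measurable_fun_bool true); rewrite setTI.
  rewrite [X in measurable X](_ : _ = `]0%E, +oo[%classic); first exact: emeasurable_itv.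
  by apply/seteqP; split=> x; rewrite /= in_itv/= andbT.
apply: (@measurable_fun_ifT _ _ (\bar R) (\bar R) _ _ (fun x => (x < +oo)%E)) => //=.
  apply: (measurable_fun_bool true); rewrite setTI.
  rewrite [X in measurable X](_ : _ = `]-oo, +oo%E[%classic); first exact: emeasurable_itv.
  by apply/seteqP; split=> x; rewrite /= in_itv.
apply/measurable_EFinP; apply: measurableT_comp => //.
Qed.

Section density.
Context d (X : measurableType d) (R : realType).
Implicit Types (m nu : probability X R) (g u : X -> R).
Local Open Scope charge_scope.

(** A real representative, nonnegative everywhere and not just almost everywhere, so that logarithms
    and convexity inequalities can be handled pointwise. [has_density_density] leads back to the
    Radon-Nikodym derivative. *)
Definition is_density m nu g := [/\ measurable_fun setT g, forall x, 0 <= g x &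
  forall A, measurable A -> m A = (\int[nu]_(x in A) (g x)%:E)%E].

Lemma dominates_density m nu : m `<< nu -> exists g, is_density m nu g.
Proof.
move=> mnu; pose f := Radon_Nikodym_SigmaFinite.f m nu.
have ffin := Radon_Nikodym_SigmaFinite.f_fin_num mnu.
exists (fine \o f); split.
- apply: measurableT_comp => //.
  exact: measurable_int (Radon_Nikodym_SigmaFinite.f_integrable mnu).
- by move=> x; rewrite /= fine_ge0//; exact: Radon_Nikodym_SigmaFinite.f_ge0.
- move=> A mA; rewrite (Radon_Nikodym_SigmaFinite.f_integral mnu)//.
  by apply: eq_integral => x _; rewrite /= fineK.
Qed.

Section properties.
Variables (m nu : probability X R) (g : X -> R).
Hypothesis mg : is_density m nu g.

Let mfg : measurable_fun setT g. Proof. by have [] := mg. Qed.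

Lemma density_dominates : m `<< nu.
Proof.
have [_ g0 mE] := mg; apply/null_content_dominatesP => A mA A0.
by rewrite [LHS]mE// null_set_integral//; apply/measurable_EFinP; exact: measurable_funTS.
Qed.

Lemma density_integrable : Rintegrable nu g.
Proof.
have [_ g0 mE] := mg; apply/integrableP; split; first exact/measurable_EFinP.
under eq_integral do rewrite /= ger0_norm//.
by rewrite -mE// -ge0_fin_numE// fin_num_measure.
Qed.

Lemma Rintegral_density : \int[nu]_x g x = 1.
Proof.
have [_ _ mE] := mg; rewrite /Rintegral -(mE _ measurableT).
by rewrite [X in fine X]probability_setT.
Qed.

Lemma density_Radon_Nikodym :
  ae_eq nu setT ('d (charge_of_finite_measure m) '/d nu) (EFin \o g).
Proof.
have [_ _ mE] := mg; have mnu := density_dominates.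
apply: integral_ae_eq => //.
- exact: Radon_Nikodym_integrable.
- exact/measurable_EFinP.
- by move=> A _ mA; rewrite -Radon_Nikodym_integral// [LHS]mE.
Qed.

Lemma has_density_density : has_density m nu g.
Proof. by split; [exact: density_dominates|exact: density_Radon_Nikodym]. Qed.

Lemma ge0_integral_density (u : X -> \bar R) : measurable_fun setT u ->
  (forall x, 0 <= u x)%E ->
  (\int[m]_x u x = \int[nu]_x (u x * (g x)%:E))%E.
Proof.
move=> mu u0; have mnu := density_dominates.
rewrite -(Radon_Nikodym_SigmaFinite.change_of_variables mnu u0)//.
have mf : measurable_fun setT (Radon_Nikodym_SigmaFinite.f m nu).
  exact: measurable_int (Radon_Nikodym_SigmaFinite.f_integrable mnu).
apply: ae_eq_integral => //.
- exact: emeasurable_funM.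
- by apply: emeasurable_funM => //; exact/measurable_EFinP.
- have h1 := ae_eq_Radon_Nikodym_SigmaFinite mnu measurableT.
  apply: filterS2 h1 density_Radon_Nikodym => x /(_ I) -> /(_ I) /= h _.
  by rewrite h.
Qed.

Lemma integrable_density u : measurable_fun setT u ->
  Rintegrable m u <-> Rintegrable nu (fun x => u x * g x).
Proof.
move=> mu; have [_ g0 mE] := mg.
have key : (\int[m]_x `|(EFin \o u) x| =
            \int[nu]_x `|(EFin \o (fun x => (u x * g x)%R)) x|)%E.
  rewrite ge0_integral_density//; last by do 2 apply: measurableT_comp => //.
  apply: eq_integral => x _.
  by rewrite /= normrM EFinM (ger0_norm (g0 x)).
split=> /integrableP[_ ui]; apply/integrableP; split.
- by apply/measurable_EFinP; exact: measurable_funM.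
- by rewrite -key.
- exact/measurable_EFinP.
- by rewrite key.
Qed.

Lemma Rintegral_densityM u : Rintegrable m u ->
  \int[m]_x u x = \int[nu]_x (u x * g x).
Proof.
move=> Iu; have mu := Rintegrable_measurable Iu.
have mnu := density_dominates.
rewrite /Rintegral -(Radon_Nikodym_change_of_variables mnu measurableT Iu).
congr fine; apply: ae_eq_integral => //.
- apply: emeasurable_funM; first exact/measurable_EFinP.
  exact: measurable_int (@Radon_Nikodym_integrable _ _ _ (charge_of_finite_measure m) nu mnu).
- by apply/measurable_EFinP; exact: measurable_funM.
- by apply: filterS density_Radon_Nikodym => x /(_ I) -> _.
Qed.

Lemma density_gt0 : {ae m, forall x, 0 < g x}.
Proof.
have [_ g0 mE] := mg.
pose A := [set x | g x <= 0].
have mA : measurable A.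
  rewrite -[A]setTI; have -> : A = g @^-1` `]-oo, 0].
    by apply/seteqP; split => x /=; rewrite in_itv.
  exact: mfg.
exists A; split => //; last by move=> x /= /negP; rewrite -leNgt.
rewrite [LHS]mE//; apply: integral0_eq => x Ax.
by congr EFin; apply/eqP; rewrite eq_le g0 Ax.
Qed.

(** [lne] and [ln] disagree only where the density vanishes, with values [-oo] and [0], and that set
    is [m]-null. *)
Lemma rel_entropy_lnE : rel_entropy m nu = (\int[m]_x (ln (g x))%:E)%E.
Proof.
have mnu := density_dominates; rewrite /rel_entropy asboolT//.
apply: ae_eq_integral => //.
- apply: measurableT_comp; first exact: measurable_fun_lne.
  exact: measurable_int (@Radon_Nikodym_integrable _ _ _ (charge_of_finite_measure m) nu mnu).
- by apply/measurable_EFinP; apply: measurableT_comp => //; exact: measurable_ln.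
- have := null_dominates_ae_eq measurableT mnu density_Radon_Nikodym.
  move=> H; apply: filterS2 H density_gt0 => x /(_ I) -> gx _.
  by rewrite -[LHS]/(lne (g x)%:E) lne_EFin.
Qed.

End properties.
End density.

Section xlnx.
Context {R : realType}.
Implicit Types a b : R.

(** The convex function [x ln x] lies above its tangent at [b]. For [a > 0] this is
    [ln (b / a) <= b / a - 1] multiplied by [a]. *)
Lemma xlnx_tangent a b : 0 <= a -> 0 < b ->
  b * ln b + (ln b + 1) * (a - b) <= a * ln a.
Proof.
rewrite le_eqVlt => /predU1P[<- b0|a0 b0]; first by rewrite mul0r; nra.
have := @le_ln1Dx R (b / a - 1).
rewrite addrCA subrr addr0 ltrBrDr addNr divr_gt0// => /(_ isT).
rewrite ln_div ?posrE// -(ler_pM2l a0) => H.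
have : a * (b / a - 1) = b - a by field; rewrite gt_eqF.
by move=> E; rewrite E in H; lra.
Qed.

Lemma xlnx_geN1 a : 0 <= a -> -1 <= a * ln a.
Proof. by move=> a0; have := xlnx_tangent a0 ltr01; rewrite ln1; lra. Qed.

End xlnx.

Section entropy.
Context d (X : measurableType d) (R : realType).
Variables (m nu : probability X R) (g : X -> R).
Hypothesis mg : is_density m nu g.

Let mfg : measurable_fun setT g. Proof. by have [] := mg. Qed.
Let g0 x : 0 <= g x. Proof. by have [_ +] := mg; exact. Qed.

(** The negative part of [ln g] under [m] is that of [g ln g] under [nu], which is at most [1]. Only
    the positive part could have an infinite integral, and finite entropy excludes it. *)
Lemma rel_entropy_lty_integrable : (rel_entropy m nu < +oo)%E ->
  Rintegrable m (fun x => ln (g x)).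
Proof.
rewrite (rel_entropy_lnE mg); set f : X -> \bar R := fun x => (ln (g x))%:E.
have mf : measurable_fun setT f by apply/measurable_EFinP; exact: measurableT_comp.
have negoo : (\int[m]_x f^\- x < +oo)%E.
  rewrite (ge0_integral_density mg)//; last exact: measurable_funeneg.
  apply: (@le_lt_trans _ _ (\int[nu]_x (cst 1%E x))%E); last first.
    by rewrite integral_cst// mul1e [X in (X < _)%E]probability_setT ltry.
  apply: ge0_le_integral => //.
  - by move=> x _; rewrite mule_ge0// lee_fin.
  - by apply: emeasurable_funM; [exact: measurable_funeneg|exact/measurable_EFinP].
  move=> x _; rewrite funenegE /f.
  have -> : (maxe (- (ln (g x))%:E) 0 = (Num.max (- ln (g x)) 0)%:E)%E.
    by rewrite EFin_max.
  rewrite -EFinM lee_fin maxr_pMl// mul0r ge_max ler01 andbT mulNr mulrC.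
  by have := xlnx_geN1 (g0 x); lra.
rewrite integralE => posoo; rewrite -[X in m.-integrable _ X]/f (funeposneg f).
have nfin : (\int[m]_x f^\- x)%E \is a fin_num.
  by rewrite ge0_fin_numE// integral_ge0.
apply: integrableB => //; apply/integrableP; split.
- exact: measurable_funepos.
- under eq_integral do rewrite gee0_abs//.
  by move: posoo; rewrite -(fineK nfin) lteBlDr// addye// ltey.
- exact: measurable_funeneg.
- by under eq_integral do rewrite gee0_abs//.
Qed.

Lemma rel_entropy_Rintegral : Rintegrable m (fun x => ln (g x)) ->
  rel_entropy m nu = (\int[m]_x (ln (g x)))%:E.
Proof.
move=> I; rewrite (rel_entropy_lnE mg) fineK//.
exact: integrable_fin_num.
Qed.

End entropy.

(** * First-order condition for the entropy along a segment of densities *)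

Section entropy_direction.
Context d (X : measurableType d) (R : realType).
Variables (nu : probability X R) (f g : X -> R).
Hypotheses (If : Rintegrable nu f) (Ig : Rintegrable nu g).
Hypotheses (f0 : forall x, 0 <= f x) (g0 : forall x, 0 <= g x).
Hypothesis fg1 : \int[nu]_x f x = \int[nu]_x g x.
Hypothesis Ihf : Rintegrable nu (fun x => f x * ln (f x)).
Hypothesis Ihg : Rintegrable nu (fun x => g x * ln (g x)).

Let mix e x := (1 - e) * f x + e * g x.

Variables (e_ c_ : R^nat) (c : R).
Hypothesis e_lt : forall n, 0 < e_ n <= 2^-1.
Hypothesis e_cvg : e_ n @[n --> \oo] --> 0.
Hypothesis c_cvg : c_ n @[n --> \oo] --> c.
Hypothesis Ihm : forall n, Rintegrable nu (fun x => mix (e_ n) x * ln (mix (e_ n) x)).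
Hypothesis hm_ge : forall n,
  - (e_ n * c_ n) <= \int[nu]_x (mix (e_ n) x * ln (mix (e_ n) x)) -
                    \int[nu]_x (f x * ln (f x)).

Let bnd x := 2 * (g x * ln (g x) + 1).
(** [(g - f) * (ln mix + 1)] is the derivative at [e_ n] of [x ln x] along the segment. By convexity
    it dominates the difference quotient between [0] and [e_ n], which optimality controls, and its
    pointwise limit is explicit. *)
Let w n x := bnd x - (g x - f x) * (ln (mix (e_ n) x) + 1).

Let mix_ge0 n x : 0 <= mix (e_ n) x.
Proof.
have /andP[e0 e1] := e_lt n.
by rewrite addr_ge0// mulr_ge0// ?(ltW e0)// subr_ge0; lra.
Qed.

Let mix_eq0 n x : mix (e_ n) x = 0 -> f x = 0 /\ g x = 0.
Proof.
have /andP[e0 e1] := e_lt n.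
move=> /eqP; rewrite paddr_eq0 ?mulr_ge0// ?(ltW e0)//; last by lra.
rewrite !mulf_eq0 (gt_eqF e0)/= => /andP[/orP[/eqP e_1|/eqP fx] /eqP gx].
  lra.
by [].
Qed.

Let bnd_ge0 x : 0 <= bnd x.
Proof. by have := xlnx_geN1 (g0 x); rewrite /bnd; lra. Qed.

(** The tangent at [mix], evaluated at [g], bounds [1 - e_ n] times the derivative by
    [g ln g - mix ln mix], hence by [g ln g + 1]. As [e_ n <= 1/2], dividing costs at most the
    factor [2] of [bnd]. *)
Let w_ge0 n x : 0 <= w n x.
Proof.
have /andP[e0 e1] := e_lt n.
have [mix0|] := eqVneq (mix (e_ n) x) 0.
  have [fx gx] := mix_eq0 mix0.
  by rewrite /w fx gx subrr mul0r subr0.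
move=> mixn0; have b0 : 0 < mix (e_ n) x by rewrite lt_def mixn0 mix_ge0.
have := xlnx_tangent (g0 x) b0; have := xlnx_geN1 (mix_ge0 n x).
have -> : g x - mix (e_ n) x = (1 - e_ n) * (g x - f x) by rewrite /mix; ring.
rewrite /w; set L := ln _ + 1; rewrite mulrCA (mulrC L).
set D := (g x - f x) * L => h1 h2.
have := bnd_ge0 x; have := xlnx_geN1 (g0 x); rewrite /bnd; nra.
Qed.

(** The same tangent, evaluated at [f]. *)
Let w_le n x : w n x <=
  bnd x - (e_ n)^-1 * (mix (e_ n) x * ln (mix (e_ n) x) - f x * ln (f x)).
Proof.
have /andP[e0 e1] := e_lt n.
rewrite /w lerD2l lerN2 ler_pdivrMl//.
have [mix0|] := eqVneq (mix (e_ n) x) 0.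
  have [fx gx] := mix_eq0 mix0.
  by rewrite mix0 fx gx !mul0r subrr mul0r mulr0.
move=> mixn0; have b0 : 0 < mix (e_ n) x by rewrite lt_def mixn0 mix_ge0.
have := xlnx_tangent (f0 x) b0.
have -> : f x - mix (e_ n) x = - (e_ n * (g x - f x)) by rewrite /mix; ring.
by set L := ln _ + 1; rewrite mulrN; nra.
Qed.

Let Ibnd : Rintegrable nu bnd.
Proof.
apply: RintegrableZ; apply: RintegrableD => //.
exact: finite_measure_integrable_cst.
Qed.

Let mf : measurable_fun setT f. Proof. exact: Rintegrable_measurable If. Qed.
Let mg : measurable_fun setT g. Proof. exact: Rintegrable_measurable Ig. Qed.

Let mw n : measurable_fun setT (w n).
Proof.
apply: measurable_funB; first exact: Rintegrable_measurable Ibnd.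
apply: measurable_funM; first exact: measurable_funB.
apply: measurable_funD => //; apply: measurableT_comp => //.
by apply: measurable_funD; apply: measurable_funM.
Qed.

Let J := \int[nu]_x bnd x.

Let w_int n : (\int[nu]_x (w n x)%:E <= (J + c_ n)%:E)%E.
Proof.
have /andP[e0 e1] := e_lt n.
pose r x := bnd x - (e_ n)^-1 * (mix (e_ n) x * ln (mix (e_ n) x) - f x * ln (f x)).
have Id := RintegrableB (Ihm n) Ihf.
have Ir : Rintegrable nu r.
  by apply: RintegrableB => //; exact: (RintegrableZ (e_ n)^-1 Id).
apply: (@le_trans _ _ (\int[nu]_x (r x)%:E)%E).
  apply: ge0_le_integral => //.
  - by move=> x _; rewrite lee_fin.
  - exact/measurable_EFinP.
  - exact: measurable_int Ir.
  - by move=> x _; rewrite lee_fin w_le.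
rewrite -(fineK (integrable_fin_num measurableT Ir)) lee_fin.
have rE : \int[nu]_x r x = J - (e_ n)^-1 *
    (\int[nu]_x (mix (e_ n) x * ln (mix (e_ n) x)) - \int[nu]_x (f x * ln (f x))).
  rewrite -RintegralB// -RintegralZl// -RintegralB//.
  exact: (RintegrableZ (e_ n)^-1 Id).
rewrite -[leLHS]/(\int[nu]_x r x) rE lerD2l lerNl ler_pdivlMl//.
by rewrite mulrN hm_ge.
Qed.

Let mix_cvg x : mix (e_ n) x @[n --> \oo] --> f x.
Proof.
rewrite -[X in _ --> X]addr0 -[X in _ --> X + _]mul1r -[X in _ --> _ + X](mul0r (g x)).
apply: cvgD; apply: cvgMl => //.
by rewrite -[X in _ --> X]subr0; apply: cvgB => //; exact: cvg_cst.
Qed.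

(* The limit of [w n x]; infinite where [f] vanishes and [g] does not. *)
Let wlim x : \bar R := if (f x == 0) && (g x != 0) then +oo%E else
  (bnd x - (g x - f x) * (ln (f x) + 1))%:E.

Let w_cvg x : (w n x)%:E @[n --> \oo] --> wlim x.
Proof.
rewrite /wlim; have [fx|fx] /= := eqVneq (f x) 0; last first.
  have f_gt0 : 0 < f x by rewrite lt_def fx f0.
  apply: cvg_EFin; first exact: nearW.
  apply: cvgB; first exact: cvg_cst.
  apply: cvgMr; apply: cvgD; last exact: cvg_cst.
  by apply: (@cvg_comp _ _ _ _ (@ln R)); [exact: mix_cvg|exact: continuous_ln].
have [gx|gx] /= := eqVneq (g x) 0.
  rewrite gx fx subrr mul0r subr0; apply: cvg_EFin; first exact: nearW.
  by rewrite [X in X @ _ --> _](_ : _ = cst (bnd x)); [exact: cvg_cst|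
    apply/funext => n; rewrite /w /comp/= gx fx subrr mul0r subr0].
have g_gt0 : 0 < g x by rewrite lt_def gx g0.
apply/cvgeyPge => A.
(* When [mix] takes this value, [bnd x - g x * (ln mix + 1)] equals [A]; for smaller values it is
   larger. *)
have d0 : 0 < expR (- ((A - bnd x) / g x + 1)) by exact: expR_gt0.
have := @mix_cvg x; rewrite fx => /cvgrPdist_le /(_ _ d0); apply: filterS => n /=.
rewrite sub0r normrN ger0_norm ?mix_ge0// => mle.
have m_gt0 : 0 < mix (e_ n) x.
  rewrite lt_def mix_ge0 andbT; apply/eqP => /mix_eq0[_ gx0].
  by rewrite gx0 eqxx in gx.
rewrite lee_fin /w fx subr0.
have : ln (mix (e_ n) x) <= - ((A - bnd x) / g x + 1).
  by rewrite -[leRHS]expRK ler_ln.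
move=> /(ler_wpM2l (g0 x)) H.
have E : g x * (- ((A - bnd x) / g x + 1)) = - (A - bnd x) - g x by field.
by move: H; rewrite E; lra.
Qed.

Let wlim_int : (\int[nu]_x wlim x <= (J + c)%:E)%E.
Proof.
have mwE n : measurable_fun setT (fun x => (w n x)%:E) by exact/measurable_EFinP.
have := @fatou _ _ _ nu setT measurableT (fun n x => (w n x)%:E).
move=> /(_ mwE).
move=> /(_ (fun n x _ => w_ge0 n x)).
under eq_integral.
  move=> x _; rewrite is_cvg_limn_einfE; last by apply/cvg_ex; eexists; exact: w_cvg.
  rewrite (cvg_lim _ (@w_cvg x))//.
  over.
move=> /le_trans; apply.
have cJ : (J + c_ n)%:E @[n --> \oo] --> (J + c)%:E.
  by apply: cvg_EFin; [exact: nearW|apply: cvgD => //; exact: cvg_cst].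
rewrite -(cvg_lim _ cJ)// limn_einf_lim; apply: lee_lim.
- exact: is_cvg_einfs.
- by apply/cvg_ex; eexists; exact: cJ.
- apply: nearW => n; rewrite (le_trans _ (w_int n))//.
  by apply: ereal_inf_lbound; exists n => /=.
Qed.

Let wlim_ge0 x : (0 <= wlim x)%E.
Proof.
rewrite -(cvg_lim _ (@w_cvg x))//; apply: lime_ge.
  by apply/cvg_ex; eexists; exact: w_cvg.
by apply: nearW => n; rewrite lee_fin.
Qed.

Let Iwlim : nu.-integrable setT wlim.
Proof.
apply/integrableP; split.
  apply: (emeasurable_fun_cvg (fun n x => (w n x)%:E)) => [n|x _].
    exact/measurable_EFinP.
  exact: w_cvg.
under eq_integral do rewrite gee0_abs//.
by rewrite (le_lt_trans wlim_int)// ltry.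
Qed.

(** The limit of Fatou's lemma has a finite integral, so the set where it is infinite is negligible;
    this is the first claim. Elsewhere it is a real function, from which [g ln f] is recovered by
    adding integrable terms. The leftover [g - f] integrates to [0] because [f] and [g] have the
    same mass. *)
Theorem entropy_direction : [/\ {ae nu, forall x, f x = 0 -> g x = 0},
  Rintegrable nu (fun x => g x * ln (f x)) &
  - c <= \int[nu]_x (g x * ln (f x)) - \int[nu]_x (f x * ln (f x))].
Proof.
have ae0 : {ae nu, forall x, f x = 0 -> g x = 0}.
  have := integrable_ae measurableT Iwlim; apply: filterS => x /(_ I).
  rewrite /wlim => + fx; rewrite fx eqxx /=.
  by have [|] := eqVneq (g x) 0.
pose wr x := bnd x - (g x - f x) * (ln (f x) + 1).
have mwr : measurable_fun setT wr.
  apply: measurable_funB; first exact: Rintegrable_measurable Ibnd.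
  apply: measurable_funM; first exact: measurable_funB.
  by apply: measurable_funD => //; exact: measurableT_comp.
have mwlim : measurable_fun setT wlim by exact: measurable_int Iwlim.
have wE : ae_eq nu setT wlim (EFin \o wr).
  apply: filterS ae0 => x fg _; rewrite /wlim /wr /=.
  by have [/fg ->|] := eqVneq (f x) 0; rewrite ?eqxx.
have Iwr : Rintegrable nu wr.
  apply/integrableP; split; first exact/measurable_EFinP.
  move/integrableP : Iwlim => [_].
  rewrite (@ae_eq_integral _ _ _ _ _ (abse \o (EFin \o wr)))//.
  - exact: measurableT_comp.
  - by apply: measurableT_comp => //; exact/measurable_EFinP.
  - by apply: filterS wE => x /(_ I) /= -> _.
have wr_le : \int[nu]_x wr x <= J + c.
  rewrite -lee_fin /Rintegral fineK; last exact: integrable_fin_num.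
  apply: le_trans wlim_int; rewrite le_eqVlt; apply/orP; left; apply/eqP.
  apply: ae_eq_integral => //; first exact/measurable_EFinP.
  by apply: filterS wE => x /(_ I) /= -> _.
have Iu : Rintegrable nu (fun x => (g x - f x) * (ln (f x) + 1)).
  apply: eq_integrable (RintegrableB Ibnd Iwr) => // x _ /=.
  by congr EFin; rewrite /wr opprB addrC subrK.
have wrE : \int[nu]_x wr x = J - \int[nu]_x ((g x - f x) * (ln (f x) + 1)).
  by rewrite -RintegralB.
have E : (fun x => g x * ln (f x)) =
    (fun x => ((g x - f x) * (ln (f x) + 1) + f x * ln (f x)) - (g x - f x)).
  by apply/funext => x; ring.
have I1 := RintegrableD Iu Ihf; have I2 := RintegrableB Ig If.
split => //; first by rewrite E; exact: RintegrableB.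
have -> : \int[nu]_x (g x * ln (f x)) =
    \int[nu]_x ((g x - f x) * (ln (f x) + 1)) + \int[nu]_x (f x * ln (f x)) -
    (\int[nu]_x g x - \int[nu]_x f x).
  rewrite -RintegralD// -(RintegralB _ Ig If)// -RintegralB//.
  by apply: eq_Rintegral => x _; exact: (congr1 (@^~ x) E).
by move: wr_le; rewrite wrE fg1; lra.
Qed.

End entropy_direction.

(** * Caratheodory functions *)

Lemma second_countable_dense (T : ptopologicalType) (B : set (set T)) :
  countable B -> exists2 D : set T, countable D &
    forall U, B U -> U !=set0 -> exists2 t, D t & U t.
Proof.
move=> cB; pose pt (U : set T) := xget point U.
exists (pt @` B); first exact: sub_countable (card_image_le _ _) cB.
by move=> U BU [t Ut]; exists (pt U); [exists U|exact: (xgetI _ Ut)].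
Qed.

Section caratheodory_function.
Context {R : realType} {T : pmetricType R} d (X : measurableType d).
Variable f : T -> X -> R.
Hypotheses (cT : compact [set: T]) (f_meas : forall t, measurable_fun setT (f t)).
Hypothesis f_cont : forall x, continuous (f ^~ x).

(* [f t x > a] means that, for some [m] and some basic neighbourhood [U] of [t],
   [f s x >= a + 1/(m+1)] for all [s] in [U]; by continuity it is enough to
   test the [s] in a countable dense set. *)
Lemma caratheodory_measurable :
  measurable_fun [set: borel T * X] (fun p : borel T * X => f p.1 p.2).
Proof.
have [B cB BB] := compact_second_countable cT.
have [D cD DB] := second_countable_dense cB.
have [Bo Bn] := BB.
apply: (measurability (@RGenOInfty.G R)); first exact: RGenOInfty.measurableE.
move=> _ [_ [a ->] <-]; rewrite setTI.
pose A (n : nat) (U : set T) : set X :=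
  \bigcap_(s in D `&` U) (f s @^-1` `[a + n.+1%:R^-1, +oo[).
have -> : (fun p : borel T * X => f p.1 p.2) @^-1` `]a, +oo[ =
    \bigcup_n \bigcup_(U in B) ((U : set (borel T)) `*` A n U).
  apply/seteqP; split=> [[t x]|[t x] [n _ [U BU [/= Ut xA]]]].
    rewrite /= in_itv/= andbT => afx.
    have [n an] : exists n : nat, a + n.+1%:R^-1 < f t x.
      by have [n /= an] := ltr_add_invr afx; exists n.
    have : nbhs t [set s | a + n.+1%:R^-1 <= f s x].
      have := @f_cont x t; rewrite /continuous_at => /cvgr_gt /(_ _ an).
      by apply: filterS => s /ltW.
    move=> /(Bn t)[U [BU Ut] Uf]; exists n => //; exists U => //; split => //.
    by move=> s [_ Us] /=; rewrite in_itv/= andbT; exact: Uf.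
  rewrite /= in_itv/= andbT (@lt_le_trans _ _ (a + n.+1%:R^-1))//.
    by rewrite ltrDl.
  rewrite leNgt; apply/negP => fa.
  have : nbhs t (U `&` [set s | f s x < a + n.+1%:R^-1]).
    apply: filterI; first by apply: open_nbhs_nbhs; split => //; exact: Bo.
    by have := @f_cont x t; rewrite /continuous_at => /cvgr_lt /(_ _ fa).
  move=> /(Bn t)[V [BV Vt] VU].
  have [|s Ds Vs] := DB V BV; first by exists t.
  have [Us fs] := VU s Vs.
  have := xA s (conj Ds Us); rewrite /= in_itv/= andbT leNgt => /negP; exact.
apply: bigcupT_measurable => n; apply: countable_bigcup_measurable => // U BU.
apply: measurableX; first by apply: sub_sigma_algebra; exact: Bo.
rewrite -[A n U]setCK; apply: measurableC; rewrite setC_bigcap.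
apply: countable_bigcup_measurable.
  exact: sub_countable (subset_card_le (@subIsetl _ _ _)) cD.
move=> s _; apply: measurableC; rewrite -[X in measurable X]setTI.
exact: f_meas.
Qed.

Section integral.
Variables (mu : probability X R) (b : X -> R).
Hypotheses (f_le : forall t x, `|f t x| <= b x) (Ib : Rintegrable mu b).

Lemma caratheodory_integrable t : Rintegrable mu (f t).
Proof. exact: (le_Rintegrable (f_meas t) (f_le t) Ib). Qed.

(** Dominated convergence speaks of sequences: in the metric space [T], a failure of continuity at
    [t] yields points [u n] in balls of radius [1/(n+1)] at which the integrals stay away from the
    one at [t]. *)
Lemma continuous_Rintegral : continuous (fun t => \int[mu]_x f t x).
Proof.
move=> t; apply/cvgrPdist_le => e e0; apply: contrapT => nF.
have nF' n : exists s, ball t n.+1%:R^-1 s /\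
    ~ `|\int[mu]_x f t x - \int[mu]_x f s x| <= e.
  apply: contrapT => H; apply: nF.
  have n0 : 0 < n.+1%:R^-1 :> R by rewrite invr_gt0.
  apply: filterS (nbhsx_ballx t _ n0) => s ts /=.
  by apply: contrapT => nE; apply: H; exists s.
have [u uP] := choice nF'.
have ut : u n @[n --> \oo] --> t.
  apply/cvg_ballP => r r0; near=> n.
  have [bu _] := uP n; apply: le_ball bu.
  rewrite -[leRHS]invrK lef_pV2 ?posrE ?invr_gt0//.
  near: n; exists (Num.truncn r^-1) => // s /= rs.
  by apply/ltW; rewrite -truncn_le_nat.
have [] := @dominated_convergence _ _ _ mu setT measurableT
  (fun n x => (f (u n) x)%:E) (fun x => (f t x)%:E) (fun x => (b x)%:E).
- by move=> n; exact/measurable_EFinP.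
- exact/measurable_EFinP.
- apply: aeW => x _; apply: cvg_EFin; first exact: nearW.
  exact: (@cvg_comp _ _ _ u (f ^~ x) _ _ _ ut (@f_cont x t)).
- exact: Ib.
- by apply: aeW => x n _; rewrite /= lee_fin.
move=> _ _ cF.
have {}cF : \int[mu]_x f (u n) x @[n --> \oo] --> \int[mu]_x f t x.
  apply: (@fine_cvg _ _ _ _ (fun n => \int[mu]_x (f (u n) x)%:E)%E).
  by rewrite fineK//; apply: integrable_fin_num => //; exact: caratheodory_integrable.
move/cvgrPdist_le : cF => /(_ _ e0)[N _ /(_ N (leqnn _))].
by have [_] := uP N.
Unshelve. all: by end_near. Qed.

Variable lam : {finite_measure set (borel T) -> \bar R}.

Let F (p : X * borel T) : \bar R := (f p.2 p.1)%:E.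

Let mF : measurable_fun setT F.
Proof.
apply/measurable_EFinP.
have := measurableT_comp caratheodory_measurable (@measurable_swap _ _ X (borel T)).
exact.
Qed.

(** The inner integral over [x] is at most that of [b] for every [t], and [lam] has finite mass. *)
Let FI : (mu \x lam)%E.-integrable setT F.
Proof.
apply/(integrable21ltyP _ _ mF).
apply: (@le_lt_trans _ _ (\int[lam]_t (cst (\int[mu]_x (b x)%:E) t))%E).
  apply: ge0_le_integral => //.
  - by move=> t _; exact: integral_ge0.
  - apply: (measurable_fun_fubini_tonelli_G (abse \o F)) => //=.
    exact: measurableT_comp.
  - move=> t _; apply: ge0_le_integral => //.
    + apply: measurableT_comp => //; apply/measurable_EFinP; exact: f_meas.
    + exact: measurable_int Ib.
    + by move=> x _; rewrite lee_fin.
rewrite integral_cst// lte_mul_pinfty//.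
- by apply: integral_ge0 => x _; rewrite lee_fin (le_trans _ (f_le point x)).
- exact: integrable_fin_num.
- by rewrite -ge0_fin_numE// fin_num_measure.
Qed.

Let FG x : (\int[lam]_t F (x, t))%E = (\int[lam]_t f t x)%:E.
Proof.
rewrite fineK//; apply: integrable_fin_num => //.
exact: compact_continuous_integrable.
Qed.

Lemma Rintegrable_caratheodory : Rintegrable mu (fun x => \int[lam]_t f t x).
Proof.
have := integrable_fubini_F FI; apply: eq_integrable => // x _.
exact: FG.
Qed.

Lemma Rintegral_caratheodory :
  \int[mu]_x (\int[lam]_t f t x) = \int[lam]_t (\int[mu]_x f t x).
Proof.
have := Fubini FI; rewrite /Rintegral => H; congr fine.
transitivity (\int[mu]_x \int[lam]_t F (x, t))%E.
  by apply: eq_integral => x _; rewrite FG.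
rewrite H; apply: eq_integral => t _.
by rewrite fineK//; apply: integrable_fin_num => //; exact: caratheodory_integrable.
Qed.

End integral.
End caratheodory_function.

(** * Mixtures and bounded perturbations *)

Section pmix.
Context d (X : measurableType d) (R : realType).
Variables (m m' : probability X R) (e : R).
Hypothesis e01 : 0 <= e <= 1.
Implicit Types u : X -> R.

Lemma ge0_integral_pmix (u : X -> \bar R) : measurable_fun setT u ->
  (forall x, 0 <= u x)%E ->
  (\int[pmix e m m']_x u x =
   (1 - e)%:E * \int[m]_x u x + e%:E * \int[m']_x u x)%E.
Proof.
move=> mu u0; rewrite /pmix ge0_integral_measure_add// !ge0_integral_mscale//=.
by rewrite clip01_id.
Qed.

Lemma integrable_pmix u : Rintegrable m u -> Rintegrable m' u ->
  Rintegrable (pmix e m m') u.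
Proof.
move=> Iu Iu'; have mu := measurable_int _ Iu; apply/integrableP; split => //.
have /andP[e0 e1] := e01.
rewrite ge0_integral_pmix//; last exact: measurableT_comp.
move/integrableP : Iu => [_ Iu]; move/integrableP : Iu' => [_ Iu'].
by rewrite lte_add_pinfty// lte_mul_pinfty// lee_fin// subr_ge0.
Qed.

Lemma integrable_of_pmix u : 0 < e -> Rintegrable (pmix e m m') u ->
  Rintegrable m' u.
Proof.
move=> e_gt0 Iu; have mu := measurable_int _ Iu; apply/integrableP; split => //.
have /andP[e0 e1] := e01.
move/integrableP : Iu => [_]; rewrite ge0_integral_pmix//; last exact: measurableT_comp.
rewrite -!ge0_fin_numE; [|exact: integral_ge0|]; last first.
  by rewrite adde_ge0// mule_ge0// ?integral_ge0// lee_fin// subr_ge0.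
rewrite fin_numD => /andP[_]; rewrite !fin_numElt => /andP[_ H].
rewrite (lt_le_trans _ (integral_ge0 _ _)) ?ltNy0//=.
rewrite ltNge; apply/negP; rewrite leye_eq => /eqP E.
by move: H; rewrite E gt0_muley// lte_fin.
Qed.

Lemma Rintegral_pmix u : Rintegrable m u -> Rintegrable m' u ->
  \int[pmix e m m']_x u x = (1 - e) * \int[m]_x u x + e * \int[m']_x u x.
Proof.
move=> Iu Iu'; have mu : measurable_fun setT (EFin \o u) by exact: measurable_int Iu.
have mp := measurable_funepos mu; have mn := measurable_funeneg mu.
have E (n : probability X R) : Rintegrable n u -> \int[n]_x u x =
    fine (\int[n]_x (EFin \o u)^\+ x)%E - fine (\int[n]_x (EFin \o u)^\- x)%E.
  move=> In; rewrite /Rintegral integralE fineB//.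
  - exact: integrable_fin_num (integrable_funepos measurableT In).
  - exact: integrable_fin_num (integrable_funeneg measurableT In).
rewrite (E _ Iu) (E _ Iu') (E _ (integrable_pmix Iu Iu')) !ge0_integral_pmix//.
have := integrable_fin_num measurableT (integrable_funepos measurableT Iu).
have := integrable_fin_num measurableT (integrable_funepos measurableT Iu').
have := integrable_fin_num measurableT (integrable_funeneg measurableT Iu).
have := integrable_fin_num measurableT (integrable_funeneg measurableT Iu').
have fineDM (x y : R) (a b : \bar R) : a \is a fin_num -> b \is a fin_num ->
    fine (x%:E * a + y%:E * b)%E = x * fine a + y * fine b.
  by move: a b => [a| |] [b| |].
by move=> *; rewrite !fineDM//; ring.
Qed.

Lemma is_density_pmix nu f g : is_density m nu f -> is_density m' nu g ->
  is_density (pmix e m m') nu (fun x => (1 - e) * f x + e * g x).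
Proof.
move=> [mf f0 mE] [mg g0 mE']; have /andP[e0 e1] := e01.
split.
- by apply: measurable_funD; exact: measurable_funM.
- by move=> x; rewrite addr_ge0// mulr_ge0// subr_ge0.
- move=> A mA; transitivity ((1 - e)%:E * m A + e%:E * m' A)%E; first exact: pmixE.
  rewrite mE// mE'//.
  under [RHS]eq_integral do rewrite EFinD !EFinM.
  have mEf : measurable_fun A (EFin \o f) by apply/measurable_EFinP; exact: measurable_funTS.
  have mEg : measurable_fun A (EFin \o g) by apply/measurable_EFinP; exact: measurable_funTS.
  have e1' : 0 <= 1 - e by rewrite subr_ge0.
  rewrite ge0_integralD//.
  + rewrite !ge0_integralZl//.
    * by move=> x _; rewrite lee_fin.
    * by move=> x _; rewrite lee_fin.
  + by move=> x _; rewrite -EFinM lee_fin mulr_ge0.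
  + exact: emeasurable_funM.
  + by move=> x _; rewrite -EFinM lee_fin mulr_ge0.
  + exact: emeasurable_funM.
Qed.

End pmix.

Section probability_of_density.
Context d (X : measurableType d) (R : realType).
Variables (nu : probability X R) (g : X -> R).
Hypotheses (mg : measurable_fun setT g) (g0 : forall x, 0 <= g x).
Hypothesis g1 : (\int[nu]_x (g x)%:E = 1)%E.

Let m A := (\int[nu]_(x in A) (g x)%:E)%E.

Let m0 : m set0 = 0%E. Proof. by rewrite /m integral_set0. Qed.

Let m_ge0 A : (0 <= m A)%E.
Proof. by apply: integral_ge0 => x _; rewrite lee_fin. Qed.

Let m_sigma_additive : semi_sigma_additive m.
Proof.
apply: semi_sigma_additive_nng_induced; first exact/measurable_EFinP.
by move=> x; rewrite lee_fin.
Qed.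

Definition density_measure (_ : measurable_fun setT g) (_ : forall x, 0 <= g x)
  (_ : (\int[nu]_x (g x)%:E = 1)%E) : set X -> \bar R := m.

HB.instance Definition _ := isMeasure.Build _ _ _ (density_measure mg g0 g1)
  m0 m_ge0 m_sigma_additive.

HB.instance Definition _ :=
  Measure_isProbability.Build _ _ _ (density_measure mg g0 g1) g1.

Lemma probability_of_density : exists p : probability X R, is_density p nu g.
Proof. by exists (density_measure mg g0 g1); split. Qed.

End probability_of_density.

Section lin_span.
Context {R : realType} {X S : Type} (zeta : S -> X -> R).

Lemma lin_span0 : lin_span zeta (cst 0).
Proof.
(* [S] may be empty, so the family indexed by ['I_0] is built by eliminating the impossible
   index. *)
exists 0, (fun i : 'I_0 => False_rect S (notF (valP i))), (fun _ => 0).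
by apply/funext => x; rewrite big_ord0.
Qed.

Lemma lin_spanD u v : lin_span zeta u -> lin_span zeta v -> lin_span zeta (u + v).
Proof.
move=> [n [s [c ->]]] [n' [s' [c' ->]]].
exists (n + n')%N, (fun i => match fintype.split i with inl j => s j | inr j => s' j end),
  (fun i => match fintype.split i with inl j => c j | inr j => c' j end).
apply/funext => x; rewrite big_split_ord/=.
rewrite -[LHS]/(\sum_(i < n) c i * zeta (s i) x + \sum_(i < n') c' i * zeta (s' i) x).
congr (_ + _); apply: eq_bigr => i _.
- by have -> : fintype.split (lshift n' i) = inl i := unsplitK (inl i).
- by have -> : fintype.split (rshift n i) = inr i := unsplitK (inr i).
Qed.

Lemma lin_spanZ a u : lin_span zeta u -> lin_span zeta (a *: u).
Proof.
move=> [n [s [c ->]]]; exists n, s, (fun i => a * c i).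
apply/funext => x; rewrite -[LHS]/(a * \sum_(i < n) c i * zeta (s i) x).
by rewrite mulr_sumr; apply: eq_bigr => i _; rewrite mulrA.
Qed.

Lemma lin_span_ind (P : (X -> R) -> Prop) : P (cst 0) ->
  (forall u v, P u -> P v -> P (u + v)) -> (forall a u, P u -> P (a *: u)) ->
  (forall s, P (zeta s)) -> forall u, lin_span zeta u -> P u.
Proof.
move=> P0 PD PZ Pz u [n [s [c ->]]].
rewrite (_ : (fun x => _) = \sum_(i < n) c i *: zeta (s i)).
  by elim/big_ind : _ => // i _; exact: PZ.
by apply/funext => x; rewrite fct_sumE.
Qed.

Lemma lin_span_gen s : lin_span zeta (zeta s).
Proof.
exists 1, (fun _ => s), (fun _ => 1).
by apply/funext => x; rewrite big_ord1 mul1r.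
Qed.

End lin_span.

Section closure.
Context d (X : measurableType d) (R : realType) (m : probability X R).
Implicit Types (u h : X -> R).

Lemma bounded_perturbation h c : measurable_fun setT h ->
  (forall x, `|h x| <= c) -> \int[m]_x h x = 0 ->
  exists2 p : probability X R, has_bounded_density p m &
    forall u, Rintegrable m u -> Rintegrable p u /\
      \int[p]_x u x = \int[m]_x u x + (`|c| + 1)^-1 * \int[m]_x (h x * u x).
Proof.
(* With this [k], [|k * h| <= 1], so that [1 + k * h] is nonnegative and at most [2]; it has mass
   [1] because [h] has mean zero. *)
move=> mh hc h0; set k := (`|c| + 1)^-1.
have k0 : 0 < k by rewrite invr_gt0 ltr_wpDl.
have kh x : `|k * h x| <= 1.
  rewrite normrM gtr0_norm// ler_pdivrMl ?ltr_wpDl// mulr1.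
  by rewrite (le_trans (hc x))// (le_trans (ler_norm c))// lerDl.
pose g x := 1 + k * h x.
have mg : measurable_fun setT g.
  by apply: measurable_funD => //; exact: measurable_funM.
have g0 x : 0 <= g x by have := kh x; rewrite ler_norml /g => /andP[+ _]; lra.
have g2 x : `|g x| <= 2.
  by rewrite ger0_norm//; have := kh x; rewrite ler_norml /g => /andP[_]; lra.
have I1 : Rintegrable m (cst 1) by exact: finite_measure_integrable_cst.
have Ih : Rintegrable m h.
  apply: (@le_Rintegrable _ _ _ _ _ (cst c)) => //.
  exact: finite_measure_integrable_cst.
have Ig : Rintegrable m g by apply: RintegrableD => //; exact: RintegrableZ.
have g1 : (\int[m]_x (g x)%:E = 1)%E.
  rewrite -(fineK (integrable_fin_num measurableT Ig)); congr EFin.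
  rewrite -[LHS]/(\int[m]_x (1 + k * h x)) RintegralD//; last exact: (RintegrableZ k Ih).
  rewrite RintegralZl// h0 mulr0 addr0 Rintegral_cst// mul1r.
  by rewrite [X in fine X]probability_setT.
have [p dp] := probability_of_density mg g0 g1; exists p.
  exists g; first exact: has_density_density.
  exists 2; split; first exact: num_real.
  by move=> M M2 x _ /=; apply: (le_trans (g2 x)); exact: ltW.
move=> u Iu; have mu := Rintegrable_measurable Iu.
have Ihu := RintegrableM mh hc Iu.
have gE : (fun x => u x * g x) = (fun x => u x + k * (h x * u x)).
  by apply/funext => x; rewrite /g; ring.
have Igu : Rintegrable m (fun x => u x * g x).
  by rewrite gE; apply: RintegrableD => //; exact: (RintegrableZ k Ihu).
have Ipu : Rintegrable p u by apply/(integrable_density dp mu).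
split => //; rewrite (Rintegral_densityM dp Ipu).
rewrite -(RintegralZl k measurableT Ihu).
rewrite -(RintegralD measurableT Iu (RintegrableZ k Ihu)).
by apply: eq_Rintegral => x _; exact: (congr1 (@^~ x) gE).
Qed.

(** Since [h] must be orthogonal to [1] as well, [L1_annihilator] gives an approximation of [G] by
    some [a + v] with [v] in the span, up to [e / 2]. As [v] has mean zero, [a] is within [e / 2] of
    the mean of [G], so [- v] approximates the centred function up to [e]. *)
Lemma L1_closure_lin_span (S : Type) (zeta : S -> X -> R) (G : X -> R) :
  (forall s, Rintegrable m (zeta s)) -> (forall s, \int[m]_x zeta s x = 0) ->
  Rintegrable m G ->
  (forall h c, measurable_fun setT h -> (forall x, `|h x| <= c) ->
    \int[m]_x h x = 0 -> (forall s, \int[m]_x (h x * zeta s x) = 0) ->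
    \int[m]_x (h x * G x) = 0) ->
  L1_closure m (lin_span zeta) (fun x => \int[m]_y G y - G x).
Proof.
move=> Iz z0 IG ann; set k := \int[m]_y G y.
have Icst (a : R) : Rintegrable m (cst a) by exact: finite_measure_integrable_cst.
have Ispan u : lin_span zeta u -> Rintegrable m u /\ \int[m]_x u x = 0.
  apply: (@lin_span_ind _ _ _ _ (fun u => Rintegrable m u /\ \int[m]_x u x = 0)) => //.
  - by split => //; rewrite Rintegral_cst// mul0r.
  - move=> v w [Iv v0] [Iw w0]; split; first exact: RintegrableD.
    by rewrite RintegralD// v0 w0 addr0.
  - move=> a v [Iv v0]; split; first exact: RintegrableZ.
    by rewrite RintegralZl// v0 mulr0.
pose M : set (X -> R) := [set u | exists a v, lin_span zeta v /\ u = cst a + v].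
have MI u : M u -> Rintegrable m u.
  by move=> [a [v [/Ispan[Iv _] ->]]]; exact: (RintegrableD (Icst a) Iv).
split; first by apply/Lfun1_integrable; exact: (RintegrableB (Icst k) IG).
move=> e e0; have e20 : 0 < e / 2 by rewrite divr_gt0.
have [||||_ [a [v [sv ->]]] Gav] := L1_annihilator (M := M) (G := G) _ _ _ MI IG _ e20.
- exists 0, (cst 0); split; first exact: lin_span0.
  by apply/funext => x; rewrite -[RHS]/(0 + 0 : R) addr0.
- move=> _ _ [a [v [sv ->]]] [a' [v' [sv' ->]]]; exists (a + a'), (v + v').
  split; first exact: lin_spanD.
  by apply/funext => x; rewrite -[LHS]/(a + v x + (a' + v' x)) addrACA.
- move=> c _ [a [v [sv ->]]]; exists (c * a), (c *: v).
  split; first exact: lin_spanZ.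
  by apply/funext => x; rewrite -[LHS]/(c * (a + v x)) mulrDr.
- move=> h c mh hc hM; apply: (ann h c mh hc).
    rewrite -(hM (cst 1)); first by apply: eq_Rintegral => x _; rewrite mulr1.
    exists 1, (cst 0); split; first exact: lin_span0.
    by apply/funext => x; rewrite -[RHS]/(1 + 0 : R) addr0.
  move=> s; apply: hM; exists 0, (zeta s); split; first exact: lin_span_gen.
  by apply/funext => x; rewrite -[RHS]/(0 + zeta s x) add0r.
have [Iv v0] := Ispan _ sv.
have Iav := RintegrableD (Icst a) Iv.
have ID := RintegrableB IG Iav.
have ka : `|k - a| < e / 2.
  apply: le_lt_trans Gav; rewrite (le_trans _ (le_normr_Rintegral measurableT ID))//.
  rewrite (RintegralB measurableT IG Iav) (RintegralD measurableT (Icst a) Iv).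
  rewrite v0 addr0 Rintegral_cst// [X in fine X]probability_setT mulr1.
  exact: lexx.
exists (-1 *: v); first exact: lin_spanZ.
rewrite Lnorm1.
have Ir : Rintegrable m (fun x => `|G x - (a + v x)| + `|k - a|).
  exact: (RintegrableD (integrable_norm ID) (Icst `|k - a|)).
apply: (@le_lt_trans _ _ (\int[m]_x (`|G x - (a + v x)| + `|k - a|))%:E).
  rewrite fineK; last exact: integrable_fin_num.
  apply: ge0_le_integral => //.
  - apply: measurableT_comp => //; apply/measurable_EFinP.
    apply: measurable_funB; last exact: Rintegrable_measurable (RintegrableZ (-1) Iv).
    exact: Rintegrable_measurable (RintegrableB (Icst k) IG).
  - exact: measurable_int Ir.
  move=> x _; rewrite /= lee_fin -[(-1 *: v) x]/(-1 * v x).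
  rewrite -(normrN (G x - (a + v x))) (le_trans _ (ler_normD _ _))//.
  by rewrite le_eqVlt; apply/orP; left; apply/eqP; congr `|_|; ring.
rewrite lte_fin (RintegralD measurableT (integrable_norm ID) (Icst `|k - a|)).
rewrite Rintegral_cst// [X in fine X]probability_setT mulr1 /=.
by rewrite [ltRHS]splitr ltrD.
Qed.

End closure.

(** * The minimiser *)

Section weighted_space.
Context (R : realType) (E : completeMetricType R) (phi : E -> R).
Hypotheses (phi_ge0 : forall x, 0 <= phi x) (phi_cont : continuous phi).
Implicit Types mu : Pphi phi.

Lemma Pphi_integrable mu : Rintegrable mu (fun x => 1 + phi x).
Proof.
apply: RintegrableD; first exact: finite_measure_integrable_cst.
apply/integrableP; split.
  by apply/measurable_EFinP; exact: continuous_borel_measurable.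
under eq_integral do rewrite /= ger0_norm//.
by case: mu.
Qed.

Lemma growth_integrable mu (f : E -> R) C : measurable_fun [set: borel E] f ->
  (forall x, `|f x| <= C * (1 + phi x)) -> Rintegrable mu f.
Proof.
move=> mf fC; apply: (le_Rintegrable mf fC).
exact: (RintegrableZ C (Pphi_integrable mu)).
Qed.

Lemma Rintegral_mix mu mu' e f : 0 <= e <= 1 -> Rintegrable mu f ->
  Rintegrable mu' f -> \int[mix e mu mu']_x f x =
    (1 - e) * \int[mu]_x f x + e * \int[mu']_x f x.
Proof. by move=> e01 If If'; rewrite Pphi_prob_mix//; exact: Rintegral_pmix. Qed.

Lemma is_density_mix nu mu mu' e f g : 0 <= e <= 1 -> is_density mu nu f ->
  is_density mu' nu g ->
  is_density (mix e mu mu') nu (fun x => (1 - e) * f x + e * g x).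
Proof. by move=> e01 df dg; rewrite Pphi_prob_mix//; exact: is_density_pmix. Qed.

Section eq_constraint.
Context (S : Type) (zeta : S -> E -> R).
Hypothesis zeta_int : forall mu s, Rintegrable mu (zeta s).

Lemma eq_constraintP mu :
  eq_constraint zeta mu <-> forall s, \int[mu]_x zeta s x = 0.
Proof.
split=> H s; first by rewrite /Rintegral H.
rewrite -[RHS]/(0%:E) -(H s) /Rintegral fineK//.
exact: (integrable_fin_num measurableT (zeta_int mu s)).
Qed.

Lemma eq_constraint_convex : convexP (@eq_constraint R E phi S zeta).
Proof.
move=> mu mu' e /eq_constraintP Z /eq_constraintP Z' e01.
by apply/eq_constraintP => s; rewrite Rintegral_mix// Z Z' !mulr0 addr0.
Qed.

End eq_constraint.

Section domain.
Variables (nu : probability (borel E) R) (F : Pphi phi -> \bar R).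
Hypothesis F_gtNy : forall mu, (-oo < F mu)%E.

Lemma dom_objective_dominates mu : dom_objective nu F mu -> mu `<< nu.
Proof. by move=> [+ _]; rewrite /rel_entropy; case: asboolP. Qed.

Lemma dom_objective_ln mu g : dom_objective nu F mu -> is_density mu nu g ->
  Rintegrable mu (fun x => ln (g x)).
Proof. by move=> [H _] dg; exact: rel_entropy_lty_integrable dg H. Qed.

Lemma dom_objective_xlnx mu g : dom_objective nu F mu -> is_density mu nu g ->
  Rintegrable nu (fun x => g x * ln (g x)).
Proof.
move=> Dmu dg; have I := dom_objective_ln Dmu dg.
have [/(_ I) + _] := integrable_density dg (Rintegrable_measurable I).
by apply: eq_integrable => // x _; rewrite /= mulrC.
Qed.

Lemma dom_objective_Rintegral_ln mu g : dom_objective nu F mu ->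
  is_density mu nu g -> \int[mu]_x ln (g x) = \int[nu]_x (g x * ln (g x)).
Proof.
move=> Dmu dg; rewrite (Rintegral_densityM dg (dom_objective_ln Dmu dg)).
by apply: eq_Rintegral => x _; rewrite mulrC.
Qed.

Lemma dom_objectiveE mu g : dom_objective nu F mu -> is_density mu nu g ->
  objective nu F mu = (\int[nu]_x (g x * ln (g x)) + fine (F mu))%:E.
Proof.
move=> Dmu dg; have I := dom_objective_ln Dmu dg.
have Ffin : F mu \is a fin_num by rewrite fin_numElt F_gtNy/=; have [] := Dmu.
rewrite /objective (rel_entropy_Rintegral dg I) dom_objective_Rintegral_ln//.
by rewrite EFinD (fineK Ffin).
Qed.

End domain.
End weighted_space.

(** * First-order conditions at the minimiser and the multiplier *)

Section gibbs_principle.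
Context (R : realType) (E : completeMetricType R) (phi : E -> R).
Hypotheses (phi_ge0 : forall x, 0 <= phi x) (phi_cont : continuous phi).
Context (nu : probability (borel E) R) (F : Pphi phi -> \bar R).
Hypothesis F_gtNy : forall mu, (-oo < F mu)%E.
Context (S : Type) (zeta : S -> E -> R).
Context (T : pmetricType R) (Psi : T -> Pphi phi -> R).
Hypothesis T_compact : compact [set: T].
Hypothesis zeta_int : forall (mu : Pphi phi) s, Rintegrable mu (zeta s).
Implicit Types mu : Pphi phi.
Variable mubar : Pphi phi.
Let D := dom_objective nu F.
Hypothesis mubar_adm :
  (D `&` (eq_constraint zeta `&` ineq_constraint Psi)) mubar.
Hypothesis mubar_min : forall mu,
  (D `&` (eq_constraint zeta `&` ineq_constraint Psi)) mu ->
  (objective nu F mubar <= objective nu F mu)%E.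
Hypothesis D_convex : convexP D.
Context (dF : E -> R) (dPsi : T -> E -> R).
Hypothesis dF_deriv : is_lfderiv D (fine \o F) mubar dF.
Hypothesis dPsi_unif : forall mu : Pphi phi,
  ereal_sup [set `|diff_quotient (Psi t) mubar mu e -
                   (\int[mu]_x dPsi t x - \int[mubar]_x dPsi t x)|%:E
            | t in [set: T]] @[e --> 0^'+] --> 0%E.
Context (eps : R) (f : E -> R).
Hypotheses (eps0 : 0 < eps) (df : is_density mubar nu f).

Let C := D `&` eq_constraint zeta.

Let Dbar : D mubar. Proof. by have [] := mubar_adm. Qed.
Let Cbar : C mubar. Proof. by have [? []] := mubar_adm. Qed.

(** The scale [eps] is that of the qualification condition. At [mubar] the value is [Psi t mubar],
    and mixtures act affinely on it. *)
Definition linearised (mu : Pphi phi) (t : T) : R :=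
  Psi t mubar + eps * (\int[mu]_x dPsi t x - \int[mubar]_x dPsi t x).

Let C_convex : convexP C.
Proof.
move=> mu mu' e [Dmu Zmu] [Dmu' Zmu'] e01; split; first exact: D_convex.
exact: eq_constraint_convex.
Qed.

(* [Psi] at the mixture is a convex combination of [Psi] at [mubar] and of the
   linearised constraint, up to the error controlled by [dPsi_unif]. *)
Lemma linearised_feasible mu eta : 0 < eta ->
  (forall t, linearised mu t <= - eta) ->
  exists2 e0, 0 < e0 & forall e, 0 < e < e0 -> ineq_constraint Psi (mix e mubar mu).
Proof.
move=> eta0 lin.
have ee0 : 0 < eta / eps by rewrite divr_gt0.
have /fine_cvgP[supfin /cvgr0Pnorm_lt /(_ _ ee0) suplt] := dPsi_unif mu.
have : \forall e \near 0^'+, forall t, diff_quotient (Psi t) mubar mu e <=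
    (\int[mu]_x dPsi t x - \int[mubar]_x dPsi t x) + eta / eps.
  apply: filterS2 supfin suplt => e sf sl t.
  rewrite -lerBlDl (le_trans (ler_norm _))// -lee_fin.
  apply: (@le_trans _ _ (ereal_sup [set `|diff_quotient (Psi t) mubar mu e -
    (\int[mu]_x dPsi t x - \int[mubar]_x dPsi t x)|%:E | t in [set: T]])).
    by apply: ereal_sup_ubound; exists t.
  rewrite -(fineK sf) lee_fin; apply: ltW; apply: le_lt_trans sl.
  exact: ler_norm.
move=> /nbhs_ballP[r /= r0 Hr].
exists (Num.min r (Num.min eps 1)); first by rewrite !lt_min r0 eps0 ltr01.
move=> e /andP[e0]; rewrite !lt_min => /and3P[er ee e1] t.
have be : ball 0 r e by rewrite /ball/= sub0r normrN gtr0_norm.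
have := Hr e be e0 t; rewrite /diff_quotient ler_pdivrMl// => H.
have := lin t; rewrite /linearised => L.
have [_ [_ Psi0]] := mubar_adm; have P0 : Psi t mubar <= 0 := Psi0 t.
have : e * (\int[mu]_x dPsi t x - \int[mubar]_x dPsi t x + eta / eps) =
    e / eps * (eps * (\int[mu]_x dPsi t x - \int[mubar]_x dPsi t x) + eta).
  by field; rewrite gt_eqF.
move=> E1; rewrite E1 in H.
have e1' : 0 < e / eps by rewrite divr_gt0.
have e1'' : e / eps <= 1 by rewrite ler_pdivrMr// mul1r ltW.
(* The bound on [Psi] at the mixture reads [(1 - q) * Psi t mubar + q * (linearised mu t + eta)],
   with both terms nonpositive. The minimum with [eps] in the choice of the range ensures
   [q <= 1]. *)
set d := eps * _ in H L; set q := e / eps in H e1' e1''; nra.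
Qed.

Lemma linearised_direction mu eta : C mu -> 0 < eta ->
  (forall t, linearised mu t <= - eta) ->
  [/\ mu `<< mubar, Rintegrable mu (fun x => ln (f x)) &
    0 <= \int[mu]_x (ln (f x) + dF x) - \int[mubar]_x (ln (f x) + dF x)].
Proof.
move=> Cmu eta0 lin; have [Dmu _] := Cmu.
have [g dg] := dominates_density (dom_objective_dominates Dmu).
have [e0 e0_gt0 feas] := linearised_feasible eta0 lin.
pose e1 := Num.min e0 1.
have e1_gt0 : 0 < e1 by rewrite lt_min e0_gt0 ltr01.
(* Denominators start at [2] because [entropy_direction] requires [e_ n <= 1/2]. *)
pose e_ n : R := e1 / n.+2%:R.
have e_gt0 n : 0 < e_ n by rewrite divr_gt0.
have e_lt n : e_ n < e1 by rewrite ltr_pdivrMr// ltr_pMr// ltr1n.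
have e_half n : 0 < e_ n <= 2^-1.
  rewrite e_gt0/= ler_pdivrMr// (@le_trans _ _ 1) ?ge_min ?lexx ?orbT//.
  by rewrite ler_pdivlMl// mulr1 ler_nat.
have e01 n : 0 <= e_ n <= 1 by have := e_half n; lra.
have e_cvg : e_ n @[n --> \oo] --> 0.
  rewrite -[X in _ --> X](mulr0 e1); apply: cvgMr.
  have := @cvg_harmonic R; rewrite -cvg_shiftS; exact.
pose c_ n := diff_quotient (fine \o F) mubar mu (e_ n).
have [mdF IdF dFq dF0] := dF_deriv.
have c_cvg : c_ n @[n --> \oo] --> (\int[mu]_x dF x - \int[mubar]_x dF x : R).
  by have /cvg_at_rightP := dFq mu Dmu; apply.
have Dmix n : D (mix (e_ n) mubar mu) by exact: D_convex.
have dmix n := is_density_mix phi_ge0 phi_cont (e01 n) df dg.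
have Ihm n := dom_objective_xlnx (Dmix n) (dmix n).
have [fm f0 _] := df; have [gm g0 _] := dg.
have [] := @entropy_direction _ _ _ nu f g (density_integrable df)
  (density_integrable dg) f0 g0 _ (dom_objective_xlnx Dbar df)
  (dom_objective_xlnx Dmu dg) e_ c_ _ e_half e_cvg c_cvg Ihm.
- by rewrite (Rintegral_density df) (Rintegral_density dg).
(* Comparing objectives at [mubar] and at a feasible mixture: [F] changes by exactly [e_ n * c_ n],
   so the entropy drops by at most that amount. *)
- move=> n; have := mubar_min (mu := mix (e_ n) mubar mu).
  have eE : e_ n * c_ n = fine (F (mix (e_ n) mubar mu)) - fine (F mubar).
    by rewrite /c_ /diff_quotient mulrA divff ?gt_eqF// mul1r.
  rewrite (dom_objectiveE F_gtNy Dbar df) (dom_objectiveE F_gtNy (Dmix n) (dmix n)).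
  rewrite lee_fin eE => H; have {}H : _ := H _; rewrite lerNl opprB.
  have : (D `&` (eq_constraint zeta `&` ineq_constraint Psi)) (mix (e_ n) mubar mu).
    split => //; split; first by have [] := C_convex Cbar Cmu (e01 n).
    by apply: feas; rewrite e_gt0 (lt_le_trans (e_lt n))// ge_min lexx.
  by move=> /H; lra.
move=> fg0 Igf ineq.
have Imu : Rintegrable mu (fun x => ln (f x)).
  apply/(integrable_density dg); first exact: measurableT_comp.
  by apply: eq_integrable Igf => // x _; rewrite /= mulrC.
have Ibar := dom_objective_ln Dbar df.
split => //.
  apply/null_content_dominatesP => A mA A0.
  have [_ _ fE] := df; have [_ _ gE] := dg.
  have : ae_eq nu A (EFin \o f) (cst 0%E).
    apply/(ae_eq_integral_abs _ mA); first by apply/measurable_EFinP; exact: measurable_funTS.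
    under eq_integral do rewrite /= ger0_norm//.
    by rewrite -fE.
  move=> fA; rewrite [LHS]gE//.
  have gA : ae_eq nu A (EFin \o g) (cst 0%E).
    by apply: filterS2 fA fg0 => x fx gx Ax; rewrite /= gx//; have [] := fx Ax.
  rewrite (ae_eq_integral (cst 0%E))//; first exact: integral0.
  by apply/measurable_EFinP; exact: measurable_funTS.
have ID := IdF _ Dmu; have IDbar := IdF _ Dbar.
rewrite !RintegralD//.
have -> : \int[mu]_x ln (f x) = \int[nu]_x (g x * ln (f x)).
  by rewrite (Rintegral_densityM dg Imu); apply: eq_Rintegral => x _; rewrite mulrC.
rewrite (dom_objective_Rintegral_ln Dbar df); move: ineq; lra.
Qed.

Hypothesis Psi_cont : continuous (fun t => Psi t mubar).
Hypothesis dPsi_meas : forall t, measurable_fun [set: borel E] (dPsi t).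
Hypothesis dPsi_cont : forall x, continuous (dPsi ^~ x).
Variable (K : R).
Hypothesis dPsi_le : forall t x, `|dPsi t x| <= K * (1 + phi x).
Variable mutilde : Pphi phi.
Hypothesis Ctilde : C mutilde.
Hypothesis qualification : forall t, linearised mutilde t < 0.

Let Ib mu : Rintegrable mu (fun x => K * (1 + phi x)).
Proof. exact: (RintegrableZ K (Pphi_integrable phi_ge0 phi_cont mu)). Qed.

Let IdPsi mu t : Rintegrable mu (dPsi t).
Proof. exact: (caratheodory_integrable dPsi_meas dPsi_le (Ib mu)). Qed.

Let cdPsi mu : continuous (fun t => \int[mu]_x dPsi t x).
Proof. exact: (continuous_Rintegral dPsi_meas dPsi_cont dPsi_le (Ib mu)). Qed.

Lemma continuous_linearised mu : continuous (linearised mu).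
Proof.
move=> t; apply: cvgD; first exact: Psi_cont.
by apply: cvgMr; apply: cvgB; exact: cdPsi.
Qed.

Lemma linearised_mix mu mu' e t : 0 <= e <= 1 -> linearised (mix e mu mu') t =
  (1 - e) * linearised mu t + e * linearised mu' t.
Proof. by move=> e01; rewrite /linearised Rintegral_mix//; ring. Qed.

Lemma linearised_slater : exists2 eta, 0 < eta &
  forall t, linearised mutilde t <= - eta.
Proof.
have [||t _ tmax] := @compact_EVT_max T R (linearised mutilde) setT _ T_compact.
- by exists point.
- exact/continuous_subspaceT/continuous_linearised.
exists (- linearised mutilde t); first by rewrite oppr_gt0.
by move=> s; rewrite opprK; apply: tmax; rewrite inE.
Qed.

Lemma admissible_direction mu : C mu ->
  [/\ mu `<< mubar, Rintegrable mu (fun x => ln (f x)) & Rintegrable mu dF].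
Proof.
move=> Cmu; have [eta eta0 sl] := linearised_slater.
have [M bM] := compact_bounded_functions T_compact (continuous_linearised (mu := mu)).
have M0 : 0 <= M by exact: le_trans (normr_ge0 _) (bM point).
(* The linearised constraint at the mixture is at most [- (1 - e) * eta + e * M = - eta + e * (M +
   eta)], which this [e] makes equal to [- eta / 2]. *)
pose e := eta / (2 * (M + eta)).
have e0 : 0 < e by rewrite divr_gt0// mulr_gt0// ltr_wpDl.
have eE : e * (M + eta) = eta / 2 by rewrite /e; field; rewrite gt_eqF// ltr_wpDl.
have e01 : 0 <= e <= 1.
  by rewrite ltW//= ler_pdivrMr ?mul1r ?mulr_gt0 ?ltr_wpDl//; lra.
have Cmix := C_convex Ctilde Cmu e01.
have eta20 : 0 < eta / 2 by rewrite divr_gt0.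
have [|dmix Imix _] := linearised_direction Cmix eta20.
  move=> t; rewrite linearised_mix//.
  have := bM t; rewrite ler_norml => /andP[_ h1]; have h2 := sl t.
  have : (1 - e) * linearised mutilde t <= (1 - e) * - eta.
    by rewrite ler_wpM2l//; lra.
  have : e * linearised mu t <= e * M by rewrite ler_wpM2l// ltW.
  move: eE; rewrite mulrDr; lra.
rewrite Pphi_prob_mix// in dmix Imix.
split; last by have [_ + _ _] := dF_deriv; apply; have [] := Cmu.
(* The mixture gives [mu] the positive weight [e], so a set that is null for the mixture is null for
   [mu]. *)
- apply/null_content_dominatesP => A mA A0.
  have /null_content_dominatesP/(_ A mA A0) := dmix.
  rewrite -[X in X = _ -> _]/(pmix e mutilde mu A) pmixE// => /eqP.
  rewrite padde_eq0 ?mule_ge0 ?lee_fin//; last 2 first.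
  + by lra.
  + by lra.
  by move=> /andP[_]; rewrite mule_eq0 eqe (gt_eqF e0) => /eqP.
- exact: (integrable_of_pmix e01 e0 Imix).
Qed.

Theorem multiplier : exists lam : {finite_measure set (borel T) -> \bar R},
  [/\ radon lam, {ae lam, forall t, Psi t mubar = 0},
    (forall mu, Rintegrable mu (fun x => \int[lam]_t dPsi t x)) &
    forall mu, C mu ->
      0 <= \int[mu]_x (ln (f x) + dF x + \int[lam]_t dPsi t x) -
           \int[mubar]_x (ln (f x) + dF x + \int[lam]_t dPsi t x)].
Proof.
pose G x := ln (f x) + dF x.
have IG mu : C mu -> Rintegrable mu G.
  by move=> /admissible_direction[_ I1 I2]; exact: RintegrableD.
have [eta eta0 sl] := linearised_slater.
pose a mu := \int[mu]_x G x - \int[mubar]_x G x.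
have [|||L [LD LZ L0] Lag] := @lagrange_multiplier R T (Pphi phi) C a linearised
    _ _ _ mutilde eta Ctilde eta0 sl.
- by move=> mu _; apply: compact_bounded_functions => //; exact: continuous_linearised.
- move=> mu mu' e Cmu Cmu' e01; exists (mix e mu mu'); split.
  + exact: C_convex.
  + rewrite /a Rintegral_mix//; [ring|exact: IG|exact: IG].
  + by move=> t; exact: linearised_mix.
- by move=> mu e Cmu e0 lin; have [] := linearised_direction Cmu e0 lin.
have BPsi : bounded_functions (fun t => Psi t mubar).
  exact: compact_bounded_functions.
pose d mu t := \int[mu]_x dPsi t x - \int[mubar]_x dPsi t x.
have cd mu : continuous (d mu) by move=> t; apply: cvgB; exact: cdPsi.
have Bd mu : bounded_functions (d mu) by exact: compact_bounded_functions.
(* The derivative part of [linearised] carries the factor [eps], which is moved into the functional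
   to be represented. *)
have Lpos : positive_linear (fun y => eps * L y).
  split.
  - by move=> y z By Bz; rewrite LD// mulrDr.
  - by move=> c y By; rewrite LZ// mulrCA.
  - by move=> y By y0; rewrite mulr_ge0 ?(ltW eps0)// L0.
have [lam rlam lamE] := riesz T_compact Lpos.
have linE mu : linearised mu = (fun t => Psi t mubar) + eps *: d mu by [].
(* One inequality is positivity of [L] with feasibility of [mubar]; the other is the Lagrange
   inequality at [mubar] itself, where [a] vanishes. *)
have LPsi : L (fun t => Psi t mubar) = 0.
  apply/eqP; rewrite eq_le; apply/andP; split.
    have BN : bounded_functions (-1 *: (fun t => Psi t mubar)).
      exact: bounded_functionsZ.
    have := L0 _ BN; rewrite LZ// mulN1r oppr_ge0; apply => t.
    rewrite -[leRHS]/(-1 * Psi t mubar) mulN1r oppr_ge0.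
    by have [_ [_]] := mubar_adm; apply.
  have := Lag _ Cbar; rewrite /a subrr add0r.
  suff -> : linearised mubar = (fun t => Psi t mubar) by [].
  by apply/funext => t; rewrite /linearised subrr mulr0 addr0.
exists lam; split => //.
- have cN : continuous (fun t => - Psi t mubar).
    by move=> t; apply: cvgN; exact: Psi_cont.
  have INPsi := compact_continuous_integrable T_compact lam cN.
  have N0 t : 0 <= - Psi t mubar.
    by rewrite oppr_ge0; have [_ [_]] := mubar_adm; apply.
  have intN : \int[lam]_t (- Psi t mubar) = 0.
    rewrite lamE//; have -> : (fun t => - Psi t mubar) = -1 *: (fun t => Psi t mubar).
      by apply/funext => t; rewrite -[RHS]/(-1 * Psi t mubar) mulN1r.
    by rewrite LZ// LPsi !mulr0.
  have := ge0_Rintegral_eq0 INPsi N0; rewrite intN => /(_ (lexx _)).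
  by apply: filterS => t /(_ I) /= /eqP; rewrite oppr_eq0 => /eqP.
- move=> mu.
  exact: (Rintegrable_caratheodory T_compact dPsi_meas dPsi_cont dPsi_le (Ib mu)).
move=> mu Cmu.
have IW m := Rintegrable_caratheodory T_compact dPsi_meas dPsi_cont dPsi_le (Ib m) lam.
have WE m := Rintegral_caratheodory T_compact dPsi_meas dPsi_cont dPsi_le (Ib m) lam.
have dE m : C m -> \int[m]_x (ln (f x) + dF x + \int[lam]_t dPsi t x) =
    \int[m]_x G x + \int[lam]_t (\int[m]_x dPsi t x).
  by move=> Cm; rewrite -WE -(RintegralD measurableT (IG _ Cm) (IW m)).
rewrite !dE//; have := Lag _ Cmu; rewrite linE LD//; last exact: bounded_functionsZ.
rewrite LPsi add0r LZ// -lamE// RintegralB//; last 2 first.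
- exact: compact_continuous_integrable.
- exact: compact_continuous_integrable.
rewrite /a; lra.
Qed.

End gibbs_principle.

Theorem theorem2p13 (R : realType)
    (E : completeMetricType R) (E_separable : separable E)
    (phi : E -> R) (phi_ge0 : forall x, 0 <= phi x) (phi_cont : continuous phi)
    (nu : probability (borel E) R)
    (F : Pphi phi -> \bar R) (F_gtNy : forall mu, (-oo < F mu)%E)
    (F_meas : borel_measurable F)
    (S : Type) (zeta : S -> E -> R)
    (T : pmetricType R) (T_compact : compact [set: T])
    (Psi : T -> Pphi phi -> R)
    (* standing assumptions *)
    (nu_exp : forall alpha : R, 0 < alpha ->
      (\int[nu]_x (expR (alpha * phi x))%:E < +oo)%E)
    (I_lsc : lower_semicontinuous (objective nu F))
    (zeta_cont : forall s, continuous (zeta s))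
    (zeta_growth : forall s, exists2 C : R, 0 <= C &
      forall x, `|zeta s x| <= C * (1 + phi x))
    (Psi_lsc : forall t, lower_semicontinuous (fun mu => (Psi t mu)%:E))
    (* the minimiser *)
    (mubar : Pphi phi)
    (mubar_adm : (dom_objective nu F `&`
                  (eq_constraint zeta `&` ineq_constraint Psi)) mubar)
    (mubar_min : objective nu F mubar =
      ereal_inf [set objective nu F mu | mu in dom_objective nu F `&`
                  (eq_constraint zeta `&` ineq_constraint Psi)])
    (* (a) *)
    (D_convex : convexP (dom_objective nu F))
    (dF : E -> R)
    (dF_deriv : is_lfderiv (dom_objective nu F) (fine \o F) mubar dF)
    (* (b) *)
    (Psi_cont : continuous (fun t => Psi t mubar))
    (dPsi : T -> E -> R)
    (dPsi_deriv : forall t, is_lfderiv [set: Pphi phi] (Psi t) mubar (dPsi t))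
    (dPsi_unif : forall mu : Pphi phi,
      ereal_sup [set `|diff_quotient (Psi t) mubar mu e -
                       (\int[mu]_x dPsi t x - \int[mubar]_x dPsi t x)|%:E
                | t in [set: T]] @[e --> 0^'+] --> 0%E)
    (dPsi_cont : forall x, continuous (dPsi ^~ x))
    (dPsi_growth : exists2 D : R, 0 <= D & forall x,
      (ereal_sup [set `|dPsi t x|%:E | t in [set: T]] <= (D * (1 + phi x))%:E)%E)
    (mutilde : Pphi phi)
    (mutilde_adm : (dom_objective nu F `&` eq_constraint zeta) mutilde)
    (epstilde : R) (epstilde_gt0 : 0 < epstilde)
    (qualification : forall t, Psi t mubar + epstilde *
      (\int[mutilde]_x dPsi t x - \int[mubar]_x dPsi t x) < 0)
    (* (c) *)
    (D_bounded_density : forall m : probability (borel E) R,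
      has_bounded_density m mubar \/ has_bounded_density m mutilde ->
      [set (mu : probability (borel E) R) | mu in dom_objective nu F] m) :
  (forall mu : Pphi phi,
     (dom_objective nu F `&` eq_constraint zeta) mu -> mu `<< mubar) /\
  exists (zetabar : E -> R)
         (lambda : {finite_measure set (borel T) -> \bar R})
         (Sbar : set (borel E)),
    let w := gibbs_weight Sbar dF zetabar dPsi lambda in
    let Z := (\int[nu]_x (w x)%:E)%E in
    [/\ zetabar \in Lfun mubar 1%E, radon lambda, measurable Sbar &
        mubar Sbar = 1%E] /\
    [/\ (0 < Z < +oo)%E,
        has_density mubar nu (fun x => (fine Z)^-1 * w x),
        L1_closure mubar (lin_span zeta) zetabar,
        (\int[mubar]_x (zetabar x)%:E = 0)%E &
        {ae lambda, forall t, Psi t mubar = 0}].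
Proof.
have mzeta s : measurable_fun [set: borel E] (zeta s).
  exact: continuous_borel_measurable.
have zeta_int (mu : Pphi phi) s : Rintegrable mu (zeta s).
  have [K _ Kz] := zeta_growth s; exact: growth_integrable (mzeta s) Kz.
have [K _ Kle] := dPsi_growth.
have dPsi_le t x : `|dPsi t x| <= K * (1 + phi x).
  by rewrite -lee_fin (le_trans _ (Kle x))//; apply: ereal_sup_ubound; exists t.
have dPsi_meas t : measurable_fun [set: borel E] (dPsi t) by have [] := dPsi_deriv t.
have lb mu : (dom_objective nu F `&` (eq_constraint zeta `&` ineq_constraint Psi)) mu ->
    (objective nu F mubar <= objective nu F mu)%E.
  by move=> Amu; rewrite mubar_min; apply: ereal_inf_lbound; exists mu.
have [Dbar [Zbar _]] := mubar_adm.
have [f df] := dominates_density (dom_objective_dominates Dbar).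
have lin t : linearised Psi mubar dPsi epstilde mutilde t < 0 by exact: qualification.
have dir := admissible_direction phi_ge0 phi_cont F_gtNy T_compact zeta_int
  mubar_adm lb D_convex dF_deriv dPsi_unif epstilde_gt0 df Psi_cont dPsi_meas
  dPsi_cont dPsi_le mutilde_adm lin.
have [lam [rlam slack IW var]] := multiplier phi_ge0 phi_cont F_gtNy T_compact
  zeta_int mubar_adm lb D_convex dF_deriv dPsi_unif epstilde_gt0 df Psi_cont
  dPsi_meas dPsi_cont dPsi_le mutilde_adm lin.
split; first by move=> mu /dir[].
pose G x := ln (f x) + dF x + \int[lam]_t dPsi t x.
have IG : Rintegrable mubar G.
  have [_ I1 I2] := dir _ (conj Dbar Zbar).
  by apply: RintegrableD; [exact: RintegrableD|exact: IW].
pose k := \int[mubar]_x G x.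
have zbar s : \int[mubar]_x zeta s x = 0.
  by have /(eq_constraintP zeta_int) := Zbar; apply.
(* Hypothesis (c) puts the perturbed measure in the domain, and orthogonality to the [zeta s] keeps
   the equality constraints. The inequality constraints need no check, since [var] already accounts
   for them through [lam]. *)
have half (h : E -> R) (c : R) : measurable_fun [set: borel E] h ->
    (forall x, `|h x| <= c) ->
    \int[mubar]_x h x = 0 -> (forall s, \int[mubar]_x (h x * zeta s x) = 0) ->
    0 <= \int[mubar]_x (h x * G x).
  move=> mh hc h0 hz.
  have [p bp pE] := bounded_perturbation mh hc h0.
  have [mu Dmu mup] := D_bounded_density p (or_introl bp).
  have Cmu : (dom_objective nu F `&` eq_constraint zeta) mu.
    split => //; apply/(eq_constraintP zeta_int) => s; rewrite mup.
    by have [_ ->] := pE _ (zeta_int mubar s); rewrite zbar hz mulr0 addr0.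
  have := var _ Cmu; rewrite mup.
  have [_] := pE _ IG; rewrite -/G => ->; rewrite addrC addKr.
  by rewrite pmulr_rge0// invr_gt0 ltr_wpDl.
(* The conditions on [h] are invariant under sign change, so [half] at [h] and at its opposite gives
   equality. *)
have ann (h : E -> R) (c : R) : measurable_fun [set: borel E] h ->
    (forall x, `|h x| <= c) ->
    \int[mubar]_x h x = 0 -> (forall s, \int[mubar]_x (h x * zeta s x) = 0) ->
    \int[mubar]_x (h x * G x) = 0.
  move=> mh hc h0 hz; apply/eqP; rewrite eq_le (half h c)// andbT -oppr_ge0.
  have Nint u : Rintegrable mubar u ->
      \int[mubar]_x (- h x * u x) = - \int[mubar]_x (h x * u x).
    move=> Iu; rewrite -mulN1r -(RintegralZl _ measurableT (RintegrableM mh hc Iu)).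
    by apply: eq_Rintegral => x _; rewrite mulN1r mulNr.
  rewrite -Nint//; apply: (half (fun x => - h x) c).
  - exact: measurableT_comp.
  - by move=> x; rewrite normrN.
  - have I1 : Rintegrable mubar (cst 1) by exact: finite_measure_integrable_cst.
    have := Nint _ I1; under eq_Rintegral do rewrite mulr1.
    by under [in RHS]eq_Rintegral do rewrite mulr1; rewrite h0 oppr0.
  - by move=> s; rewrite Nint// hz oppr0.
have clos := L1_closure_lin_span (zeta_int mubar) zbar IG ann.
have [mf f0 fE] := df.
(* An exponential never vanishes, so the zeros of [f] have to be carried by the indicator. *)
pose Sbar : set (borel E) := [set x | 0 < f x].
have mS : measurable Sbar.
  rewrite -[Sbar]setTI; have -> : Sbar = f @^-1` `]0, +oo[.
    by apply/seteqP; split => x /=; rewrite in_itv/= andbT.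
  exact: mf.
exists (fun x => k - G x), lam, Sbar => w Z.
(* With [zetabar = k - G] the exponent on [Sbar] collapses to [ln f - k]. The weight is thus a
   constant multiple of [f], and [Z = expR (- k)] follows from [f] having mass [1]. *)
have wE x : w x = expR (- k) * f x.
  rewrite /w /gibbs_weight indicE; have [|nS] := boolP (x \in Sbar).
    rewrite inE /Sbar/= => fx; rewrite mul1r.
    rewrite [X in expR X](_ : _ = - k + ln (f x)); last by rewrite /G; ring.
    by rewrite expRD lnK.
  rewrite mul0r; have -> : f x = 0; last by rewrite mulr0.
  apply/eqP; rewrite eq_le f0 andbT leNgt; apply/negP => fx.
  by move/negP : nS; apply; exact: mem_set.
have ZE : Z = (expR (- k))%:E.
  have If := density_integrable df.
  rewrite /Z; under eq_integral do rewrite wE.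
  rewrite -(fineK (integrable_fin_num measurableT (RintegrableZ (expR (- k)) If))).
  rewrite -[LHS]/((\int[nu]_x (expR (- k) * f x))%:E) RintegralZl//.
  by rewrite (Rintegral_density df) mulr1.
split; first split => //.
- by have [] := clos.
- have : ({ae mubar, forall x, Sbar x}) by exact: density_gt0 df.
  move=> [A [mA A0 SA]]; apply/eqP; rewrite eq_le probability_le1//=.
  rewrite -(probability_setT mubar) -(setUv Sbar).
  rewrite (le_trans (measureU2 _ mS (measurableC mS)))//.
  rewrite [X in (_ + X)%E](_ : _ = 0%E) ?adde0//.
  apply/eqP; rewrite -measure_le0 -A0; apply: le_measure; rewrite ?inE//.
  exact: measurableC.
split => //.
- by rewrite ZE lte_fin expR_gt0 ltry.
- rewrite (_ : (fun x => _) = f); first exact: has_density_density.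
  by apply/funext => x; rewrite wE ZE /= mulrA mulVf ?mul1r// gt_eqF// expR_gt0.
- have Ik : Rintegrable mubar (cst k) by exact: finite_measure_integrable_cst.
  have IkG := RintegrableB Ik IG.
  rewrite -(fineK (integrable_fin_num measurableT IkG)); congr EFin.
  rewrite -[LHS]/(\int[mubar]_x (cst k x - G x)) (RintegralB measurableT Ik IG).
  by rewrite Rintegral_cst// [X in fine X]probability_setT mulr1 subrr.
Qed.
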